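(* Let $k$ be an algebraically closed field of characteristic zero and let $H$ be a Hopf algebra over $k$. Suppose that $A$ and $L$ are semisimple Hopf subalgebras of $H$ such that $A\cap L = k$, and that $A$ is a normal Hopf subalgebra of $H$. Then $A\#L\cong AL$ as Hopf algebras via the multiplication map $\phi: a\# l\mapsto al$.
   Context: A Hopf subalgebra $A\subseteq H$ is normal if $h_1 A S(h_2)\subseteq A$ and $S(h_1)Ah_2\subseteq A$ for all $h\in H$ (Sweedler notation, $S$ the antipode). $k$ also denotes the trivial Hopf subalgebra $k1_H$. $AL$ is the linear span of products $al$ with $a\in A$, $l\in L$; since $A$ is normal it is a Hopf subalgebra of $H$. $L$ acts on $A$ by the adjoint action $l.a=l_1aS(l_2)$, and $A\#L$ denotes the vector space $A\otimes L$ (with $a\otimes l$ written $a\#l$) with smash product multiplication $(a\#l)(a'\#l')=a(l_1.a')\#l_2l'$, unit $1\#1$, and the tensor product coalgebra structure; the claim includes that this is a Hopf algebra. *)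

(* Defs.v *)
From HB Require Import structures.
From mathcomp Require Import all_boot all_order all_algebra.
From mathcomp Require Import generic_quotient sesquilinear.
From mathcomp Require Import boolp classical_sets.

Set Implicit Arguments.
Unset Strict Implicit.
Unset Printing Implicit Defensive.

Import GRing.Theory.
Local Open Scope ring_scope.
Local Open Scope quotient_scope.

(** [tens V W] is the free commutative monoid on V * W (finite sequences up to
  reordering) modulo the bilinear relations; the opposite of v (x) w is
  (- v) (x) w. *)

Section TensorRel.
Variables (k : fieldType) (V W : lmodType k).

Inductive tens_rel : seq (V * W) -> seq (V * W) -> Prop :=
| TensRefl s : tens_rel s s
| TensSym s t of tens_rel s t : tens_rel t s
| TensTrans s t u of tens_rel s t & tens_rel t u : tens_rel s u
| TensCat s1 s2 t1 t2 of tens_rel s1 s2 & tens_rel t1 t2 :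
    tens_rel (s1 ++ t1) (s2 ++ t2)
| TensSwap s t : tens_rel (s ++ t) (t ++ s)
| TensAddl v v' w : tens_rel [:: (v + v', w)] [:: (v, w); (v', w)]
| TensAddr v w w' : tens_rel [:: (v, w + w')] [:: (v, w); (v, w')]
| TensScale a v w : tens_rel [:: (a *: v, w)] [:: (v, a *: w)]
| TensZero w : tens_rel [:: (0, w)] [::].

Definition tens_relb (s t : seq (V * W)) : bool := `[< tens_rel s t >].

Lemma tens_relb_equiv : equiv_class_of tens_relb.
Proof.
split=> [s|s t|t s u].
- exact/asboolP/TensRefl.
- by apply/asboolP/asboolP => /TensSym.
- by move=> /asboolP st /asboolP tu; apply/asboolP/(TensTrans st).
Qed.

Canonical tens_relb_equiv_rel := EquivRelPack tens_relb_equiv.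

Definition tens : Type := {eq_quot tens_relb}.
HB.instance Definition _ := Choice.on tens.

Definition tens_of (s : seq (V * W)) : tens := \pi_({eq_quot tens_relb}) s.
Definition tens_repr (x : tens) : seq (V * W) :=
  repr (x : {eq_quot tens_relb}).

Lemma tens_reprK x : tens_of (tens_repr x) = x.
Proof. exact: reprK. Qed.

Lemma tens_ofP s t : tens_of s = tens_of t <-> tens_rel s t.
Proof.
split=> [|st]; first by move/eqmodP/asboolP.
exact/eqmodP/asboolP.
Qed.

Lemma tens_repr_of s : tens_rel (tens_repr (tens_of s)) s.
Proof. by apply/tens_ofP; rewrite tens_reprK. Qed.

Definition tens_scale_seq (a : k) (s : seq (V * W)) :=
  [seq (a *: p.1, p.2) | p <- s].

Lemma tens_scale_rel a s t :
  tens_rel s t -> tens_rel (tens_scale_seq a s) (tens_scale_seq a t).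
Proof.
elim=> {s t} [s|s t _|s t u _ st _|s1 s2 t1 t2 _ IHs _ IHt|s t|v v' w|v w w'
  |b v w|w].
- exact: TensRefl.
- exact: TensSym.
- exact: TensTrans.
- by rewrite /tens_scale_seq !map_cat; apply: TensCat.
- by rewrite /tens_scale_seq !map_cat; apply: TensSwap.
- by rewrite /= scalerDr; apply: TensAddl.
- exact: TensAddr.
- by rewrite /= scalerA mulrC -scalerA; apply: TensScale.
- by rewrite /= scaler0; apply: TensZero.
Qed.

Definition tens_add (x y : tens) : tens := tens_of (tens_repr x ++ tens_repr y).
Definition tens_scale (a : k) (x : tens) : tens :=
  tens_of (tens_scale_seq a (tens_repr x)).
Definition tens_opp (x : tens) : tens := tens_scale (-1) x.
Definition tens_zero : tens := tens_of [::].

Lemma tens_add_of s t : tens_add (tens_of s) (tens_of t) = tens_of (s ++ t).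
Proof. by apply/tens_ofP/TensCat; apply: tens_repr_of. Qed.

Lemma tens_scale_of a s :
  tens_scale a (tens_of s) = tens_of (tens_scale_seq a s).
Proof. exact/tens_ofP/tens_scale_rel/tens_repr_of. Qed.

Lemma tens_addA : associative tens_add.
Proof.
move=> x y z; rewrite -[x]tens_reprK -[y]tens_reprK -[z]tens_reprK.
by rewrite !tens_add_of catA.
Qed.

Lemma tens_addC : commutative tens_add.
Proof. by move=> x y; apply/tens_ofP/TensSwap. Qed.

Lemma tens_add0 : left_id tens_zero tens_add.
Proof. by move=> x; rewrite -[x]tens_reprK tens_add_of. Qed.

Lemma tens_scaleDl (x : tens) (a b : k) :
  tens_scale (a + b) x = tens_add (tens_scale a x) (tens_scale b x).
Proof.
rewrite /tens_scale tens_add_of; elim: (tens_repr x) => //= -[v w] s IHs.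
apply/tens_ofP; rewrite -[_ :: _ in X in tens_rel X _]cat1s scalerDl.
set y := (a *: v, w); set z := (b *: v, w).
apply: TensTrans (TensCat (TensAddl _ _ _) (iffLR (tens_ofP _ _) IHs)) _.
rewrite /= -/y -/z -[y :: _]cat1s -[y :: map _ _ ++ _]cat1s.
apply: TensCat (TensRefl _) _; rewrite -cat1s catA -[z :: map _ _]cat1s [in X in tens_rel _ X]catA.
exact: TensCat (TensSwap _ _) (TensRefl _).
Qed.

Lemma tens_scale0 (x : tens) : tens_scale 0 x = tens_zero.
Proof.
rewrite /tens_scale; elim: (tens_repr x) => //= -[v w] s IHs.
apply/tens_ofP; rewrite -cat1s -[[::]]cat0s scale0r.
exact: TensCat (TensZero _) (iffLR (tens_ofP _ _) IHs).
Qed.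

Lemma tens_scale1 : left_id 1 tens_scale.
Proof.
move=> x; rewrite -[RHS]tens_reprK /tens_scale; congr tens_of.
by rewrite -[RHS]map_id; apply: eq_map => -[v w] /=; rewrite scale1r.
Qed.

Lemma tens_addN : left_inverse tens_zero tens_opp tens_add.
Proof.
move=> x; rewrite -[X in tens_add _ X]tens_scale1 /tens_opp -tens_scaleDl.
by rewrite addNr tens_scale0.
Qed.

HB.instance Definition _ :=
  GRing.isZmodule.Build tens tens_addA tens_addC tens_add0 tens_addN.

Lemma tens_of_cat s t : tens_of (s ++ t) = tens_of s + tens_of t.
Proof. exact/esym/tens_add_of. Qed.

Lemma tens_scaleA a b (x : tens) :
  tens_scale a (tens_scale b x) = tens_scale (a * b) x.
Proof.
rewrite -[x]tens_reprK !tens_scale_of; congr tens_of.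
by rewrite /tens_scale_seq -map_comp; apply: eq_map => p /=; rewrite scalerA.
Qed.

Lemma tens_scaleDr : right_distributive tens_scale +%R.
Proof.
move=> a x y; rewrite -[x]tens_reprK -[y]tens_reprK.
rewrite -tens_of_cat !tens_scale_of -tens_of_cat.
by rewrite /tens_scale_seq map_cat.
Qed.

HB.instance Definition _ := GRing.Zmodule_isLmodule.Build k tens
  tens_scaleA tens_scale1 tens_scaleDr (fun x => @tens_scaleDl x).

Lemma tens_of_scale a s : tens_of (tens_scale_seq a s) = a *: tens_of s.
Proof. exact/esym/tens_scale_of. Qed.

Definition tpure (v : V) (w : W) : tens := tens_of [:: (v, w)].

Lemma tens_of_sum s : tens_of s = \sum_(p <- s) tpure p.1 p.2.
Proof.
elim: s => [|[v w] s IHs]; first by rewrite big_nil.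
by rewrite big_cons -IHs -tens_of_cat.
Qed.

Lemma tens_sum (x : tens) : x = \sum_(p <- tens_repr x) tpure p.1 p.2.
Proof. by rewrite -tens_of_sum tens_reprK. Qed.

Lemma tpure_bilinear : bilinear_for *:%R *:%R tpure.
Proof.
split=> [w a u v|v a u w].
  by rewrite /tpure /= -tens_of_scale -tens_of_cat; apply/tens_ofP/TensAddl.
rewrite /tpure /= -tens_of_scale -tens_of_cat.
apply/tens_ofP; apply: TensTrans (TensAddr _ _ _) _; rewrite -cat1s.
by apply: (TensCat (t1 := [:: _])); [apply/TensSym/TensScale|apply: TensRefl].
Qed.

End TensorRel.

Notation "v \ox w" := (tpure v w) (at level 40, left associativity) : ring_scope.

(** The linear map V (x) W -> U induced by f, meaningful when f is bilinear
    (see [tlift_pure] and [tlift_linear]). *)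
Definition tlift (k : fieldType) (V W U : lmodType k) (f : V -> W -> U)
    (x : tens V W) : U := \sum_(p <- tens_repr x) f p.1 p.2.

Section TensorLift.
Variables (k : fieldType) (V W U : lmodType k) (f : V -> W -> U).
Hypothesis f_bil : bilinear_for *:%R *:%R f.

Lemma tlift_rel s t : tens_rel s t ->
  \sum_(p <- s) f p.1 p.2 = \sum_(p <- t) f p.1 p.2.
Proof.
have [fl fr] := f_bil.
have fDl v v' w : f (v + v') w = f v w + f v' w.
  by have := fl w 1 v v'; rewrite /= !scale1r; apply.
have fDr v w w' : f v (w + w') = f v w + f v w'.
  by have := fr v 1 w w'; rewrite /= !scale1r; apply.
have f0l w : f 0 w = 0 by apply: (addrI (f 0 w)); rewrite -fDl !addr0.
have f0r v : f v 0 = 0 by apply: (addrI (f v 0)); rewrite -fDr !addr0.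
have fZl a v w : f (a *: v) w = a *: f v w.
  by have := fl w a v 0; rewrite f0l !addr0.
have fZr a v w : f v (a *: w) = a *: f v w.
  by have := fr v a w 0; rewrite f0r !addr0.
elim=> {s t} [s|s t _ ->|s t u _ -> _ ->|s1 s2 t1 t2 _ IHs _ IHt|s t|v v' w
  |v w w'|a v w|w] //.
- by rewrite !big_cat /= IHs IHt.
- by rewrite !big_cat /= addrC.
- by rewrite !big_cons !big_nil /= !addr0 fDl.
- by rewrite !big_cons !big_nil /= !addr0 fDr.
- by rewrite !big_cons !big_nil /= fZl fZr.
- by rewrite !big_cons !big_nil /= f0l addr0.
Qed.

Lemma tlift_of s : tlift f (tens_of s) = \sum_(p <- s) f p.1 p.2.
Proof. exact/tlift_rel/tens_repr_of. Qed.

Lemma tlift_pure v w : tlift f (v \ox w) = f v w.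
Proof. by rewrite tlift_of big_seq1. Qed.

Lemma tlift_linear : linear (tlift f).
Proof.
move=> a x y; rewrite -[x]tens_reprK -[y]tens_reprK.
rewrite -tens_of_scale -tens_of_cat !tlift_of.
rewrite big_cat /= big_map scaler_sumr; congr (_ + _).
apply: eq_bigr => -[v w] _ /=; have [fl _] := f_bil.
have f0 : f 0 w = 0.
  by have := fl w (-1) 0 0; rewrite /= scaler0 addr0 scaleN1r addNr.
by have := fl w a v 0; rewrite f0 !addr0.
Qed.

End TensorLift.

Definition tmap (k : fieldType) (V W V' W' : lmodType k)
    (f : V -> V') (g : W -> W') : tens V W -> tens V' W' :=
  tlift (fun v w => f v \ox g w).

Definition tassoc (k : fieldType) (U V W : lmodType k) :
    tens (tens U V) W -> tens U (tens V W) :=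
  tlift (fun x w => tlift (fun u v => u \ox (v \ox w)) x).

Record hopf_data (k : fieldType) (V : lmodType k) := HopfData {
  hmul : V -> V -> V;
  hone : V;
  hcomul : V -> tens V V;
  hcounit : V -> k;
  hantip : V -> V
}.

(** The multiplication of the algebra V (x) V:
    (a (x) b)(c (x) d) = ac (x) bd. *)
Definition tmul (k : fieldType) (V : lmodType k) (m : V -> V -> V)
    (x y : tens V V) : tens V V :=
  tlift (fun a b => tlift (fun c d => m a c \ox m b d) y) x.

Record is_hopf (k : fieldType) (V : lmodType k) (D : hopf_data V) : Prop :=
  IsHopf {
  hopf_mul_bilinear : bilinear_for *:%R *:%R (hmul D);
  hopf_mulA : associative (hmul D);
  hopf_mul1l : left_id (hone D) (hmul D);
  hopf_mul1r : right_id (hone D) (hmul D);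
  hopf_comul_linear : linear (hcomul D);
  hopf_counit_linear : scalar (hcounit D);
  hopf_coassoc : forall x,
    tassoc (tmap (hcomul D) id (hcomul D x)) = tmap id (hcomul D) (hcomul D x);
  hopf_counitl : forall x, tlift (fun a b => hcounit D a *: b) (hcomul D x) = x;
  hopf_counitr : forall x, tlift (fun a b => hcounit D b *: a) (hcomul D x) = x;
  hopf_comulM : forall x y,
    hcomul D (hmul D x y) = tmul (hmul D) (hcomul D x) (hcomul D y);
  hopf_comul1 : hcomul D (hone D) = hone D \ox hone D;
  hopf_counitM : forall x y,
    hcounit D (hmul D x y) = hcounit D x * hcounit D y;
  hopf_counit1 : hcounit D (hone D) = 1;
  hopf_antip_linear : linear (hantip D);
  hopf_antipl : forall x,
    tlift (fun a b => hmul D (hantip D a) b) (hcomul D x)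
      = hcounit D x *: hone D;
  hopf_antipr : forall x,
    tlift (fun a b => hmul D a (hantip D b)) (hcomul D x)
      = hcounit D x *: hone D
}.

Record hopf_iso (k : fieldType) (V W : lmodType k)
    (D : hopf_data V) (E : hopf_data W) (f : V -> W) : Prop := HopfIso {
  hopf_iso_linear : linear f;
  hopf_iso_bij : bijective f;
  hopf_isoM : forall x y, f (hmul D x y) = hmul E (f x) (f y);
  hopf_iso1 : f (hone D) = hone E;
  hopf_iso_comul : forall x, tmap f f (hcomul D x) = hcomul E (f x);
  hopf_iso_counit : forall x, hcounit E (f x) = hcounit D x;
  hopf_iso_antip : forall x, f (hantip D x) = hantip E (f x)
}.

Structure hopfAlg (k : fieldType) := HopfAlg {
  hopf_sort :> algType k;
  comul : hopf_sort -> tens hopf_sort hopf_sort;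
  counit : hopf_sort -> k;
  antip : hopf_sort -> hopf_sort;
  hopf_laws : is_hopf (HopfData *%R 1 comul counit antip)
}.
Arguments comul {k h} _.
Arguments counit {k h} _.
Arguments antip {k h} _.

Structure hopfSub (k : fieldType) (H : hopfAlg k) := HopfSub {
  hsub_pred :> {pred H};
  hsub_subalg : subalg_closed hsub_pred;
  hsub_comul : forall x, x \in hsub_pred ->
    exists2 s : seq (H * H),
      {in s, forall p, (p.1 \in hsub_pred) /\ (p.2 \in hsub_pred)} &
      comul x = \sum_(p <- s) p.1 \ox p.2;
  hsub_antip : forall x, x \in hsub_pred -> antip x \in hsub_pred
}.

Section HopfSubType.
Variables (k : fieldType) (H : hopfAlg k) (A : hopfSub H).

HB.instance Definition _ :=
  GRing.isSubalgClosed.Build k H (hsub_pred A) (hsub_subalg A).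

Definition hsub : Type := {x : H | x \in hsub_pred A}.

HB.instance Definition _ := SubChoice.on hsub.
HB.instance Definition _ := [SubChoice_isSubAlgebra of hsub by <:].

End HopfSubType.

Lemma linear_retraction (k : fieldType) (V : lmodType k) (S : {pred V}) :
  submod_closed S ->
  exists r : V -> V,
    [/\ linear r, forall x, r x \in S & forall x, x \in S -> r x = x].
Proof.
move=> [S0 Slin].
have SZ a x : x \in S -> a *: x \in S.
  by move=> Sx; rewrite -[_ *: _]addr0; apply: Slin.
have SB x y : x \in S -> y \in S -> x - y \in S.
  by move=> Sx Sy; rewrite addrC -scaleN1r; apply: Slin.
pose P (B : set V) := (forall a x y, B x -> B y -> B (a *: x + y)) /\
  (forall x, B x -> x \in S -> x = 0).
have [F FP Ftot|B [[Blin BS] Bmax]] := @Zorn_bigcup _ P.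
  split=> [a x y [X FX Xx] [Y FY Yy]|x [X FX Xx]]; last exact: (FP _ FX).2.
  have [XY|YX] := Ftot _ _ FX FY.
    by exists Y => //; apply: (FP _ FY).1 => //; apply: XY.
  by exists X => //; apply: (FP _ FX).1 => //; apply: YX.
have BZ a x : B 0 -> B x -> B (a *: x).
  by move=> B0 Bx; rewrite -[_ *: _]addr0; apply: Blin.
have B0 : B 0.
  apply: contrapT => nB0; apply: (Bmax [set 0]%classic).
    split=> [x Bx|/(_ 0 erefl)//]; case: nB0.
    by rewrite -[0](addNr x) -scaleN1r; apply: Blin.
  by split=> [a x y -> ->|x ->//]; rewrite scaler0 addr0.
have dec v : exists s, s \in S /\ B (v - s).
  apply: contrapT => nv.
  have Bsub b : B b -> exists c, exists2 b', B b' & b = c *: v + b'.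
    by move=> Bb; exists 0, b => //; rewrite scale0r add0r.
  apply: (Bmax [set x | exists c, exists2 b, B b & x = c *: v + b]%classic).
    split=> // vB; apply: nv; exists 0; split=> //; rewrite subr0; apply: vB.
    by exists 1, 0 => //; rewrite scale1r addr0.
  split=> [a x y [c [b Bb ->]] [d [e Be ->]]|x [c [b Bb ->]] xS].
    exists (a * c + d), (a *: b + e); first exact: Blin.
    by rewrite scalerDr scalerA scalerDl addrACA.
  have [c0|c0] := eqVneq c 0.
    by move: xS; rewrite c0 scale0r add0r; apply: BS.
  case: nv; exists (c^-1 *: (c *: v + b)); split; first exact: SZ.
  rewrite scalerDr scalerK // opprD addNKr -scaleNr; exact: BZ.
have [r rP] := choice dec.
have rE x s : s \in S -> B (x - s) -> r x = s.
  move=> Ss Bs; have [Sr Br] := rP x; apply/eqP; rewrite -subr_eq0; apply/eqP.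
  apply: BS; last exact: SB.
  by have := Blin (-1) _ _ Br Bs; rewrite scaleN1r opprB addrA addrNK.
exists r; split=> [a x y|x|x Sx].
- apply: rE; first by apply: Slin; apply: (rP _).1.
  rewrite opprD addrACA -scalerBr; apply: Blin; apply: (rP _).2.
- exact: (rP _).1.
- by apply: rE; rewrite ?subrr.
Qed.

Section TensorMap.
Variable k : fieldType.
Implicit Types U V W : lmodType k.

Lemma tlift_sum V W U (f : V -> W -> U) : bilinear_for *:%R *:%R f ->
  forall s, tlift f (\sum_(p <- s) p.1 \ox p.2) = \sum_(p <- s) f p.1 p.2.
Proof. by move=> fb s; rewrite -tens_of_sum tlift_of. Qed.

Lemma tens_ind V W (P : tens V W -> Prop) :
  (forall s, P (\sum_(p <- s) p.1 \ox p.2)) -> forall x, P x.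
Proof. by move=> Ps x; rewrite [x]tens_sum. Qed.

Lemma tmap_bilinear V W V' W' (f : V -> V') (g : W -> W') :
  linear f -> linear g -> bilinear_for *:%R *:%R (fun v w => f v \ox g w).
Proof.
move=> fl gl; have [tl tr] := @tpure_bilinear k V' W'.
split=> [w a u v|v a u w] /=; first by rewrite fl; apply: tl.
by rewrite gl; apply: tr.
Qed.

Lemma tmap_sum V W V' W' (f : V -> V') (g : W -> W') :
  linear f -> linear g -> forall s : seq (V * W),
  tmap f g (\sum_(p <- s) p.1 \ox p.2)
    = \sum_(p <- [seq (f q.1, g q.2) | q <- s]) p.1 \ox p.2.
Proof.
move=> fl gl s; rewrite /tmap tlift_sum ?big_map //; exact: tmap_bilinear.
Qed.

Lemma tmap_linear V W V' W' (f : V -> V') (g : W -> W') :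
  linear f -> linear g -> linear (tmap f g).
Proof. by move=> fl gl; apply/tlift_linear/tmap_bilinear. Qed.

Lemma tmap_cancel V W V' W' (f : V -> V') (f' : V' -> V)
    (g : W -> W') (g' : W' -> W) :
  linear f -> linear g -> linear f' -> linear g' ->
  cancel f f' -> cancel g g' -> cancel (tmap f g) (tmap f' g').
Proof.
move=> fl gl fl' gl' fK gK; elim/tens_ind => s.
rewrite !tmap_sum // -map_comp; congr (\sum_(p <- _) _).
by rewrite -[RHS]map_id; apply: eq_map => -[v w] /=; rewrite fK gK.
Qed.

End TensorMap.

Section HopfSubAlg.
Variables (k : fieldType) (H : hopfAlg k) (A : hopfSub H).

Lemma hsub_val_linear : linear (val : hsub A -> H).
Proof. exact: linearP. Qed.

Lemma hsub_retraction : exists2 r : H -> hsub A, linear r & cancel val r.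
Proof.
have [r [rl rA rK]] := linear_retraction (hsub_subalg A : submod_closed _).
exists (fun x => exist _ (r x) (rA x) : hsub A) => [a x y|x].
  by apply: val_inj; rewrite linearP /= rl.
by apply: val_inj; apply/rK/(valP x).
Qed.

(** A (x) A -> H (x) H is injective, so that the comultiplication of A is
    determined by that of H. *)
Lemma hsub_tmap_inj :
  injective (tmap val val : tens (hsub A) (hsub A) -> tens H H).
Proof.
have [r rl rK] := hsub_retraction.
by apply/can_inj/(tmap_cancel hsub_val_linear hsub_val_linear rl rl rK rK).
Qed.

Lemma hsub_comul_ex (x : hsub A) :
  exists t : tens (hsub A) (hsub A), tmap val val t = comul (val x).
Proof.
have [s sA ->] := hsub_comul (valP x).
exists (\sum_(p <- [seq (insubd 0 q.1, insubd 0 q.2) | q <- s]) p.1 \ox p.2).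
rewrite tmap_sum; [|exact: hsub_val_linear|exact: hsub_val_linear].
congr (\sum_(p <- _) _); rewrite -map_comp -[RHS]map_id.
by apply/eq_in_map => -[v w] /sA /= [vA wA]; rewrite !insubdK.
Qed.

Definition sub_comul (x : hsub A) : tens (hsub A) (hsub A) :=
  projT1 (cid (hsub_comul_ex x)).

Lemma sub_comulE x : tmap val val (sub_comul x) = comul (val x).
Proof. exact: projT2 (cid (hsub_comul_ex x)). Qed.

Definition sub_antip (x : hsub A) : hsub A :=
  exist _ (antip (val x)) (hsub_antip (valP x)).

Definition sub_data : hopf_data (hsub A) :=
  HopfData *%R 1 sub_comul (fun x => counit (val x)) sub_antip.

End HopfSubAlg.

Section TensorMore.
Variable k : fieldType.
Implicit Types U V W : lmodType k.

Lemma linear_sum V W (g : V -> W) : linear g ->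
  forall I (s : seq I) (F : I -> V), g (\sum_(i <- s) F i) = \sum_(i <- s) g (F i).
Proof.
move=> gl I s F; elim: s => [|i s IHs].
  by rewrite !big_nil -[0 in LHS](addNr 0) -scaleN1r gl scaleN1r addNr.
by rewrite !big_cons -[F i]scale1r gl !scale1r IHs.
Qed.

Lemma linear_tlift V W U U' (f : V -> W -> U) (g : U -> U') : linear g ->
  forall x, g (tlift f x) = tlift (fun v w => g (f v w)) x.
Proof. by move=> gl x; rewrite /tlift linear_sum. Qed.

Lemma tlift_tmap V W V' W' U (f : V' -> W' -> U) (g : V -> V') (h : W -> W') :
  bilinear_for *:%R *:%R f -> linear g -> linear h ->
  forall x, tlift f (tmap g h x) = tlift (fun v w => f (g v) (h w)) x.
Proof.
move=> fb gl hl x; rewrite /tmap (linear_tlift _ (tlift_linear fb)).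
by rewrite /tlift; apply: eq_bigr => p _; rewrite -/(tlift f _) tlift_pure.
Qed.

Lemma tmap_tmap V W V' W' V'' W'' (g : V -> V') (h : W -> W')
    (g' : V' -> V'') (h' : W' -> W'') :
  linear g -> linear h -> linear g' -> linear h' ->
  forall x, tmap g' h' (tmap g h x) = tmap (g' \o g) (h' \o h) x.
Proof.
by move=> gl hl gl' hl' x; rewrite [LHS]tlift_tmap //; apply: tmap_bilinear.
Qed.

Lemma tmap_pure V W V' W' (f : V -> V') (g : W -> W') :
  linear f -> linear g -> forall v w, tmap f g (v \ox w) = f v \ox g w.
Proof. by move=> fl gl v w; rewrite /tmap tlift_pure //; apply: tmap_bilinear. Qed.

Lemma bilinear_comp V W V' W' U (f : V' -> W' -> U) (g : V -> V') (h : W -> W') :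
  bilinear_for *:%R *:%R f -> linear g -> linear h ->
  bilinear_for *:%R *:%R (fun v w => f (g v) (h w)).
Proof.
move=> [fl fr] gl hl; split=> [w a u v|v a u w] /=.
  by rewrite gl; apply: fl.
by rewrite hl; apply: fr.
Qed.

Lemma bilinear_lcomp V W U U' (f : V -> W -> U) (g : U -> U') :
  bilinear_for *:%R *:%R f -> linear g ->
  bilinear_for *:%R *:%R (fun v w => g (f v w)).
Proof.
move=> [fl fr] gl; split=> [w a u v|v a u w] /=.
  by have /= -> := fl w a u v; rewrite gl.
by have /= -> := fr v a u w; rewrite gl.
Qed.

Lemma tlift_ext V W U (f g : V -> W -> U) : (forall v w, f v w = g v w) ->
  forall x, tlift f x = tlift g x.
Proof. by move=> fg x; apply: eq_bigr => p _; apply: fg. Qed.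

Lemma tlift_param_bilinear V W V' U (f : V -> V' -> W -> U) :
  (forall w, bilinear_for *:%R *:%R (fun v v' => f v v' w)) ->
  (forall v v', linear (f v v')) ->
  bilinear_for *:%R *:%R (fun x w => tlift (fun v v' => f v v' w) x).
Proof.
move=> fb fl; split=> [w|x a u v] /=; first exact/tlift_linear/fb.
rewrite /tlift scaler_sumr -big_split; apply: eq_bigr => p _ /=; exact: fl.
Qed.

Lemma tassoc_bilinear U V W : bilinear_for *:%R *:%R
  (fun (x : tens U V) (w : W) => tlift (fun u v => u \ox (v \ox w)) x).
Proof.
have pl (X Y : lmodType k) := (@tpure_bilinear k X Y).1.
have pr (X Y : lmodType k) := (@tpure_bilinear k X Y).2.
apply: tlift_param_bilinear => [w|u v a w w'].
  split=> [v a u u'|u a v v'] /=; first exact: pl.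
  by have /= -> := pl _ _ w a v v'; apply: pr.
by have /= -> := pr _ _ v a w w'; apply: pr.
Qed.

Lemma tassoc_linear U V W : linear (@tassoc k U V W).
Proof. exact/tlift_linear/tassoc_bilinear. Qed.

Lemma tassoc_tmap U V W U' V' W' (f : U -> U') (g : V -> V') (h : W -> W') :
  linear f -> linear g -> linear h -> forall x,
  tassoc (tmap (tmap f g) h x) = tmap f (tmap g h) (tassoc x).
Proof.
move=> fl gl hl x; have fg := tmap_linear fl gl; have gh := tmap_linear gl hl.
rewrite {1}/tassoc tlift_tmap //; last exact: tassoc_bilinear.
rewrite {1}/tassoc (linear_tlift _ (tmap_linear fl gh)).
apply: tlift_ext => y w; rewrite (linear_tlift _ (tmap_linear fl gh)).
rewrite tlift_tmap //; last first.
  have pl (X Y : lmodType k) := (@tpure_bilinear k X Y).1.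
  have pr (X Y : lmodType k) := (@tpure_bilinear k X Y).2.
  split=> [v a u u'|u a v v'] /=; first exact: pl.
  by have /= -> := pl _ _ (h w) a v v'; apply: pr.
by apply: tlift_ext => u v; rewrite !tmap_pure.
Qed.

Lemma tmul_bilinear V (m : V -> V -> V) : bilinear_for *:%R *:%R m ->
  bilinear_for *:%R *:%R (tmul m).
Proof.
move=> mb.
have [ml mr] := mb; have [tl tr] := @tpure_bilinear k V V.
have mrr a b : bilinear_for *:%R *:%R (fun c d => m a c \ox m b d).
  by apply: tmap_bilinear; [apply: mr|apply: mr].
have mll c d : bilinear_for *:%R *:%R (fun a b => m a c \ox m b d).
  by apply: (tmap_bilinear (f := m^~ c) (g := m^~ d)); [apply: ml|apply: ml].
apply: tlift_param_bilinear => [y|a b]; last exact: tlift_linear.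
split=> [b c u v|a c u v] /=; rewrite /tlift scaler_sumr -big_split;
  apply: eq_bigr => p _ /=.
- exact: (mll p.1 p.2).1.
- exact: (mll p.1 p.2).2.
Qed.

Lemma tmap_tmul V W (m : V -> V -> V) (n : W -> W -> W) (f : V -> W) :
  bilinear_for *:%R *:%R m -> bilinear_for *:%R *:%R n -> linear f ->
  (forall x y, f (m x y) = n (f x) (f y)) ->
  forall x y, tmap f f (tmul m x y) = tmul n (tmap f f x) (tmap f f y).
Proof.
move=> mb nb fl fM x y; have ffl := tmap_linear fl fl.
have tb := tmap_bilinear fl fl.
have H1 z : bilinear_for *:%R *:%R
    (fun a b => tlift (fun c d => n a c \ox n b d) z).
  split=> [b c u v|a c u v] /=; rewrite /tlift scaler_sumr -big_split;
  apply: eq_bigr => p _ /=.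
    have /= -> := nb.1 p.1 c u v; exact: (tpure_bilinear _ _).1.
  have /= -> := nb.1 p.2 c u v; exact: (tpure_bilinear _ _).2.
rewrite /tmul tlift_tmap // (linear_tlift _ ffl).
apply: tlift_ext => a b; rewrite (linear_tlift _ ffl) tlift_tmap //.
  by apply: tlift_ext => c d; rewrite tmap_pure // !fM.
by apply: tmap_bilinear; [apply: nb.2|apply: nb.2].
Qed.

End TensorMore.

Section SubHopf.
Variables (k : fieldType) (H : hopfAlg k) (A : hopfSub H).
Local Notation v := (val : hsub A -> H).
Let vl : linear v := @hsub_val_linear k H A.
Let HH := hopf_laws H.

Let cl : linear (@comul k H) := hopf_comul_linear HH.
Let mb : bilinear_for *:%R *:%R (@GRing.mul H) := hopf_mul_bilinear HH.

Lemma sub_mul_bilinear : bilinear_for *:%R *:%R (@GRing.mul (hsub A)).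
Proof.
split=> [w a x y|x a y w] /=; first by rewrite mulrDl scalerAl.
by rewrite mulrDr scalerAr.
Qed.

Lemma sub_comul_linear : linear (@sub_comul k H A).
Proof.
move=> a x y; apply: hsub_tmap_inj.
by rewrite (tmap_linear vl vl) !sub_comulE vl cl.
Qed.

Lemma sub_hopf : is_hopf (sub_data A).
Proof.
have sl := sub_comul_linear; have sb := sub_mul_bilinear.
have [r rl rK] := hsub_retraction A.
have vvl := tmap_linear vl vl; have rrl := tmap_linear rl rl.
have cE x : tmap val val (hcomul (sub_data A) x) = comul (val x).
  exact: sub_comulE.
have Sl : linear (@antip k H) := hopf_antip_linear HH.
have el : scalar (@counit k H) := hopf_counit_linear HH.
have sSl : linear (@sub_antip k H A).
  by move=> a x y; apply: val_inj; rewrite [RHS]vl -[LHS]/(antip (v (a *: x + y))) vl Sl.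
have tv (U : lmodType k) (f : H -> H -> U) x : bilinear_for *:%R *:%R f ->
    tlift (fun a b => f (v a) (v b)) (sub_comul x) = tlift f (comul (v x)).
  by move=> fb; rewrite -sub_comulE tlift_tmap.
split=> //=.
- exact: mulrA.
- exact: mul1r.
- exact: mulr1.
- by move=> a x y; rewrite vl el.
- move=> x.
  have inj3 : injective (tmap v (tmap v v)).
    apply: can_inj (tmap_cancel vl vvl rl rrl rK _).
    exact: tmap_cancel.
  apply: inj3; rewrite -tassoc_tmap //.
  rewrite tmap_tmap // [RHS]tmap_tmap //.
  have E1 : tmap v v \o @sub_comul k H A = @comul k H \o v.
    by apply/funext => y /=; apply: sub_comulE.
  rewrite E1 -[v in tmap _ (v \o id)]/(id \o v).
  rewrite -[v \o id in RHS]/(id \o v).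
  rewrite -(tmap_tmap vl vl cl (h' := id)) //.
  rewrite -(tmap_tmap vl vl (g' := id) _ cl) //.
  by rewrite sub_comulE; apply: (hopf_coassoc HH).
- move=> x; apply: val_inj; rewrite (linear_tlift _ vl) /=.
  rewrite (tv _ (fun a b => counit a *: b)); first exact: (hopf_counitl HH).
  split=> [w a u u'|u a w w'] /=; first by rewrite el scalerDl scalerA.
  by rewrite scalerDr !scalerA mulrC.
- move=> x; apply: val_inj; rewrite (linear_tlift _ vl) /=.
  rewrite (tv _ (fun a b => counit b *: a)); first exact: (hopf_counitr HH).
  split=> [w a u u'|u a w w'] /=; first by rewrite scalerDr !scalerA mulrC.
  by rewrite el scalerDl scalerA.
- move=> x y; apply: hsub_tmap_inj; rewrite sub_comulE.
  rewrite (tmap_tmul sb mb vl) // !sub_comulE; exact: (hopf_comulM HH).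
- apply: hsub_tmap_inj; rewrite sub_comulE tmap_pure //; exact: (hopf_comul1 HH).
- move=> x y; exact: (hopf_counitM HH).
- exact: (hopf_counit1 HH).
- move=> x; apply: val_inj; rewrite (linear_tlift _ vl) /=.
  rewrite (tv _ (fun a b => antip a * b)); first exact: (hopf_antipl HH).
  by apply: (bilinear_comp mb Sl (h := id)).
- move=> x; apply: val_inj; rewrite (linear_tlift _ vl) /=.
  rewrite (tv _ (fun a b => a * antip b)); first exact: (hopf_antipr HH).
  by apply: (bilinear_comp mb (g := id) _ Sl).
Qed.

Definition sub_hopfAlg : hopfAlg k := HopfAlg sub_hopf.

End SubHopf.

Definition semisimple_module (R : nzRingType) (M : lmodType R) : Prop :=
  forall N : {pred M}, submod_closed N ->
  exists N' : {pred M}, [/\ submod_closed N',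
    forall x, x \in N -> x \in N' -> x = 0 &
    forall x, exists y z, [/\ y \in N, z \in N' & x = y + z]].

(** The submodules of R^o are the left ideals of R. *)
Definition semisimple_ring (R : nzRingType) : Prop :=
  @semisimple_module R R^o.

Section Adjoint.
Variables (k : fieldType) (H : hopfAlg k).

Definition adjl (h a : H) : H := tlift (fun h1 h2 => h1 * a * antip h2) (comul h).

Definition adjr (h a : H) : H := tlift (fun h1 h2 => antip h1 * a * h2) (comul h).

Definition normal_hopf (A : hopfSub H) : Prop :=
  (forall h a, a \in A -> adjl h a \in A) /\
  (forall h a, a \in A -> adjr h a \in A).

Definition in_prod_span (A L : hopfSub H) (x : H) : Prop :=
  exists2 s : seq (H * H),
    {in s, forall p, (p.1 \in A) /\ (p.2 \in L)} &
    x = \sum_(p <- s) p.1 * p.2.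

End Adjoint.

(** The comultiplication of the tensor product of two coalgebras:
    a (x) l |-> (a_1 (x) l_1) (x) (a_2 (x) l_2). *)
Definition tens_comul (k : fieldType) (V W : lmodType k)
    (DV : V -> tens V V) (DW : W -> tens W W) :
    tens V W -> tens (tens V W) (tens V W) :=
  tlift (fun a l => tlift (fun a1 a2 => tlift (fun l1 l2 =>
    (a1 \ox l1) \ox (a2 \ox l2)) (DW l)) (DV a)).

Section Smash.
Variables (k : fieldType) (H : hopfAlg k) (A L : hopfSub H).
Hypothesis nA : normal_hopf A.
Local Notation AtL := (tens (hsub A) (hsub L)).

Definition adj_act (l : hsub L) (a : hsub A) : hsub A :=
  exist _ (adjl (val l) (val a)) (nA.1 (val l) (val a) (valP a)).

(** (a # l)(a' # l') = a (l_1 . a') # l_2 l' *)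
Definition smash_mul (x y : AtL) : AtL :=
  tlift (fun a l => tlift (fun a' l' => tlift (fun l1 l2 =>
    (a * adj_act l1 a') \ox (l2 * l')) (sub_comul l)) y) x.

Definition smash_counit (x : AtL) : k :=
  tlift (U := k^o) (fun a l => counit (val a) * counit (val l)) x.

Definition smash_data (S : AtL -> AtL) : hopf_data AtL :=
  HopfData smash_mul (1 \ox 1)
    (tens_comul (@sub_comul k H A) (@sub_comul k H L)) smash_counit S.

Lemma adj_act_bilinear : bilinear_for *:%R *:%R adj_act.
Proof.
have HH := hopf_laws H; have Sl : linear (@antip k H) := hopf_antip_linear HH.
have vA := @hsub_val_linear k H A; have vL := @hsub_val_linear k H L.
have lb a : bilinear_for *:%R *:%R (fun h1 h2 : H => h1 * a * antip h2).
  split=> [w c x y|x c y w] /=; first by rewrite !mulrDl !scalerAl.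
  by rewrite Sl mulrDr scalerAr.
have cl : linear (@comul k H) := hopf_comul_linear HH.
have vE l a : val (adj_act l a) = adjl (val l) (val a) by [].
split=> [a c x y|l c x y] /=; apply: val_inj; rewrite [RHS]vA !vE /adjl.
  by rewrite vL cl (tlift_linear (lb _)).
rewrite vA /tlift scaler_sumr -big_split; apply: eq_bigr => p _ /=.
by rewrite mulrDr mulrDl -scalerAr -scalerAl.
Qed.

Lemma smash_mul_pure a l a' l' :
  smash_mul (a \ox l) (a' \ox l') =
  tlift (fun l1 l2 => (a * adj_act l1 a') \ox (l2 * l')) (sub_comul l).
Proof.
have [pl pr] := @tpure_bilinear k (hsub A) (hsub L).
have [ml mr] := @sub_mul_bilinear k H A; have [nl nr] := @sub_mul_bilinear k H L.
have [dl dr] := adj_act_bilinear; have cl := @sub_comul_linear k H L.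
have b1 (b b' : hsub A) (m' : hsub L) : bilinear_for *:%R *:%R
    (fun l1 l2 : hsub L => (b * adj_act l1 b') \ox (l2 * m')).
  apply: (tmap_bilinear (f := fun u => b * adj_act u b') (g := fun v => v * m'));
    last by move=> c x y; rewrite mulrDl scalerAl.
  move=> c x y; by have /= -> := dl b' c x y; apply: mr.
have b2 b m : bilinear_for *:%R *:%R (fun b' m' => tlift (fun l1 l2 =>
    (b * adj_act l1 b') \ox (l2 * m')) (sub_comul m)).
  split=> [m' c x y|b' c x y] /=; rewrite /tlift scaler_sumr -big_split;
    apply: eq_bigr => p _ /=.
    by have /= -> := dr p.1 c x y; have /= -> := mr b c (adj_act p.1 x) (adj_act p.1 y); apply: pl.
  by have /= -> := nr p.2 c x y; apply: pr.
rewrite /smash_mul tlift_pure.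
  by rewrite tlift_pure.
split=> [m c x y|b c x y] /=; rewrite {1 2 3}/tlift scaler_sumr -big_split;
  apply: eq_bigr => p _ /=.
  rewrite /tlift scaler_sumr -big_split; apply: eq_bigr => q _ /=.
  by have /= -> := ml (adj_act q.1 p.1) c x y; apply: pl.
by rewrite cl; apply: (tlift_linear (b1 b p.1 p.2)).
Qed.

End Smash.
Arguments smash_data {k H A} L nA S.

(* Main.v *)
(** With t and u normalised two-sided integrals of A and L, normality makes t
  central in H, and t a = counit a *: t for a in A. Hence if a # l |-> a l kills
  T, multiplying the second tensor factor of comul (a l) by t leaves
  a l_1 (x) t l_2, so that T = 0 as soon as l |-> l t is injective on L.

  For the latter, let g : L -> L t be that map, a quotient of Hopf algebras.
  The integral g u of L t yields a functional phi on L t with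
  phi(x_1) x_2 = phi(x) 1 and phi(g u) = 1. The element z = phi(g u_1) u_2 of L
  is coinvariant for g, hence lies in A (a coinvariant of H modulo A is in A),
  hence in the intersection k, and so z = 1. Finally
  phi(g (u_1 l)) u_2 = phi(g u_1) u_2 S(l) = S(l), so g l = 0 implies S(l) = 0
  and l = 0. *)

Require Import Defs.
From HB Require Import structures.
From mathcomp Require Import all_boot all_order all_algebra.
From mathcomp Require Import sesquilinear boolp.

Set Implicit Arguments.
Unset Strict Implicit.
Unset Printing Implicit Defensive.

Import GRing.Theory.
Local Open Scope ring_scope.

(** Sweedler notation: E is summed over comul x = \sum a \ox b. *)
Notation "\sw_ ( a , b <- x ) E" := (tlift (fun a b => E) (comul x))
  (at level 36, E at level 36, a name, b name,
   format "\sw_ ( a ,  b  <-  x )  E") : ring_scope.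

(** * Linear maps and tensors *)

Section Linearity.
Variable k : fieldType.
Implicit Types U V W : lmodType k.

Lemma linD V W (f : V -> W) : linear f -> forall x y, f (x + y) = f x + f y.
Proof. by move=> fl x y; have := fl 1 x y; rewrite !scale1r. Qed.

Lemma lin0 V W (f : V -> W) : linear f -> f 0 = 0.
Proof. by move=> fl; apply: (addrI (f 0)); rewrite -linD ?addr0. Qed.

Lemma linZ V W (f : V -> W) : linear f -> forall a x, f (a *: x) = a *: f x.
Proof. by move=> fl a x; rewrite -[_ *: x]addr0 fl (lin0 fl) addr0. Qed.

Lemma linB V W (f : V -> W) : linear f -> forall x y, f (x - y) = f x - f y.
Proof. by move=> fl x y; rewrite linD // -scaleN1r linZ // scaleN1r. Qed.

Lemma lin_id V : linear (fun x : V => x).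
Proof. by []. Qed.

Lemma lin_comp V W U (h : W -> U) (f : V -> W) :
  linear h -> linear f -> linear (fun x => h (f x)).
Proof. by move=> hl fl a x y; rewrite fl hl. Qed.

Lemma lin_add V W (f g : V -> W) :
  linear f -> linear g -> linear (fun x => f x + g x).
Proof. by move=> fl gl a x y; rewrite fl gl scalerDr addrACA. Qed.

Lemma lin_opp V W (f : V -> W) : linear f -> linear (fun x => - f x).
Proof. by move=> fl a x y; rewrite fl opprD scalerN. Qed.

Lemma lin_scaler V W c (f : V -> W) : linear f -> linear (fun x => c *: f x).
Proof. by move=> fl a x y; rewrite fl scalerDr !scalerA mulrC. Qed.

Lemma lin_scalel V W (f : V -> k^o) (w : W) :
  linear f -> linear (fun x => f x *: w).
Proof. by move=> fl a x y; rewrite fl scalerDl scalerA. Qed.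

Lemma lin_mull V (B : algType k) (f : V -> B) b :
  linear f -> linear (fun x => f x * b).
Proof. by move=> fl a x y; rewrite fl mulrDl scalerAl. Qed.

Lemma lin_mulr V (B : algType k) (f : V -> B) b :
  linear f -> linear (fun x => b * f x).
Proof. by move=> fl a x y; rewrite fl mulrDr scalerAr. Qed.

Lemma lin_tpurel V W U (f : V -> W) (z : U) :
  linear f -> linear (fun x => f x \ox z).
Proof. by move=> fl a x y; rewrite fl; apply: (tpure_bilinear _ _).1. Qed.

Lemma lin_tpurer V W U (f : V -> W) (z : U) :
  linear f -> linear (fun x => z \ox f x).
Proof. by move=> fl a x y; rewrite fl; apply: (tpure_bilinear _ _).2. Qed.

Lemma lin_tlift_fun V V' W U (f : U -> V -> W -> V') (z : tens V W) :
  (forall v w, linear (fun x => f x v w)) -> linear (fun x => tlift (f x) z).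
Proof.
move=> fl a x y; rewrite /tlift scaler_sumr -big_split /=.
by apply: eq_bigr => p _; apply: fl.
Qed.

Lemma lin_tlift V V' W U (f : V -> W -> V') (g : U -> tens V W) :
  bilinear_for *:%R *:%R f -> linear g -> linear (fun x => tlift f (g x)).
Proof. by move=> fb; apply/lin_comp/tlift_linear. Qed.

Lemma tlift_exchange V W V' W' U (f : V -> W -> V' -> W' -> U)
    (x : tens V W) (y : tens V' W') :
  tlift (fun a b => tlift (fun c d => f a b c d) y) x =
  tlift (fun c d => tlift (fun a b => f a b c d) x) y.
Proof. exact: exchange_big. Qed.

Lemma tlift_id V W (T : tens V W) : tlift (@tpure _ V W) T = T.
Proof. by rewrite [RHS]tens_sum. Qed.

End Linearity.

Section HopfLinear.
Variables (k : fieldType) (H : hopfAlg k).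

Lemma lin_comul : linear (@comul k H).
Proof. exact: (hopf_comul_linear (hopf_laws H)). Qed.

Lemma lin_counit : linear (@counit k H : H -> k^o).
Proof. exact: (hopf_counit_linear (hopf_laws H)). Qed.

Lemma lin_antip : linear (@antip k H).
Proof. exact: (hopf_antip_linear (hopf_laws H)). Qed.

End HopfLinear.

(** [lin] proves the linearity, or the multilinearity in the variables at
    hand, of an expression built from linear and bilinear maps. *)
Ltac lin_base :=
  first [ assumption | exact: lin_comul | exact: lin_counit | exact: lin_antip
        | exact: hsub_val_linear | exact: lin_id | exact: lin_mulr (@lin_id _ _)
        | exact: lin_tpurer (@lin_id _ _) | by apply: tmap_linear
        | match goal with h : bilinear_for _ _ ?f |- _ => first
            [ exact: (h.1 _) | exact: (h.2 _) ] end
        | match goal with h : forall _, _ |- _ => exact: h end ].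

Ltac lin :=
  cbv beta;
  match goal with
  | |- GRing.linear_for _ (fun _x => _x) => exact: lin_id
  | |- GRing.linear_for _ (fun _x => @?f _x + @?g _x) =>
      apply: (@lin_add _ _ _ f g); lin
  | |- GRing.linear_for _ (fun _x => - @?f _x) => apply: (@lin_opp _ _ _ f); lin
  | |- GRing.linear_for _ (fun _x => tlift (@?f _x) ?z) =>
      apply: lin_tlift_fun => ? ?; lin
  | |- GRing.linear_for _ (fun _x => tlift ?f (@?z _x)) =>
      apply: (@lin_tlift _ _ _ _ _ f z); lin
  | |- GRing.linear_for _ (fun _x => ?a *: @?g _x) =>
      apply: (@lin_scaler _ _ _ a g); lin
  | |- GRing.linear_for _ (fun _x => @?f _x *: ?v) =>
      apply: (@lin_scalel _ _ _ f v); lin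
  | |- GRing.linear_for _ (fun _x => ?a * @?g _x) => apply: lin_mulr; lin
  | |- GRing.linear_for _ (fun _x => @?f _x * ?v) => apply: lin_mull; lin
  | |- GRing.linear_for _ (fun _x => ?a \ox @?g _x) => apply: lin_tpurer; lin
  | |- GRing.linear_for _ (fun _x => @?f _x \ox ?v) => apply: lin_tpurel; lin
  | |- GRing.linear_for _ (tlift _) => apply: tlift_linear; lin
  | |- GRing.linear_for _ _ => first [ lin_base | lin_app ]
  | |- bilinear_for _ _ _ => split=> ?; lin
  | |- forall _, _ => intro; lin
  end
with lin_app :=
  match goal with
  | |- GRing.linear_for _ (fun _x => counit (@?f _x)) =>
      apply: (lin_comp (@lin_counit _ _) (f := f)); lin
  | |- GRing.linear_for _ (fun _x => ?h (@?f _x)) =>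
      apply: (@lin_comp _ _ _ _ h f); [lin_base|lin]
  | |- GRing.linear_for _ (fun _x => ?h (@?f _x) ?b) =>
      apply: (@lin_comp _ _ _ _ (fun y => h y b) f); [lin_base|lin]
  end.

(** * Sweedler calculus in a Hopf algebra *)

Section Sweedler.
Variables (k : fieldType) (H : hopfAlg k).
Implicit Types (x y : H) (U : lmodType k).

(** The trilinear [f] induces a linear map [F] on H (x) (H (x) H), and [F] is applied to both sides
    of the coassociativity axiom. *)
Lemma sw_coassoc U (f : H -> H -> H -> U) x :
  (forall b c, linear (fun a => f a b c)) ->
  (forall a c, linear (fun b => f a b c)) ->
  (forall a b, linear (fun c => f a b c)) ->
  \sw_(a, c <- x) \sw_(a1, a2 <- a) f a1 a2 c =
  \sw_(a, c <- x) \sw_(c1, c2 <- c) f a c1 c2.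
Proof.
move=> f1 f2 f3.
pose F (z : tens H (tens H H)) := tlift (fun a => tlift (fun b c => f a b c)) z.
have Fb : bilinear_for *:%R *:%R
  (fun a (z : tens H H) => tlift (fun b c => f a b c) z) by lin.
have fb a : bilinear_for *:%R *:%R (f a) by lin.
have Fl : linear F by rewrite /F; lin.
have al := @tassoc_linear k H H H.
have := congr1 F (hopf_coassoc (hopf_laws H) x) => /=.
rewrite /tmap !(linear_tlift _ (lin_comp Fl al)) (linear_tlift _ Fl).
under tlift_ext => a c.
  rewrite /tassoc tlift_pure; last exact: tassoc_bilinear.
  rewrite (linear_tlift _ Fl).
  under tlift_ext => a1 a2 do rewrite /F tlift_pure // tlift_pure //.
  over.
under [RHS]tlift_ext => a c do rewrite /F tlift_pure //.
by [].
Qed.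

Lemma sw_counitl U (g : H -> U) x :
  linear g -> \sw_(a, b <- x) (counit a *: g b) = g x.
Proof.
move=> gl; rewrite -[in RHS](hopf_counitl (hopf_laws H) x) (linear_tlift _ gl).
by apply: tlift_ext => a b; rewrite linZ.
Qed.

Lemma sw_counitr U (g : H -> U) x :
  linear g -> \sw_(a, b <- x) (counit b *: g a) = g x.
Proof.
move=> gl; rewrite -[in RHS](hopf_counitr (hopf_laws H) x) (linear_tlift _ gl).
by apply: tlift_ext => a b; rewrite linZ.
Qed.

Lemma sw_antipl U (g : H -> U) x :
  linear g -> \sw_(a, b <- x) g (antip a * b) = counit x *: g 1.
Proof.
move=> gl; rewrite -(linear_tlift _ gl) -linZ //.
by rewrite (hopf_antipl (hopf_laws H) x).
Qed.

Lemma sw_antipr U (g : H -> U) x :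
  linear g -> \sw_(a, b <- x) g (a * antip b) = counit x *: g 1.
Proof.
move=> gl; rewrite -(linear_tlift _ gl) -linZ //.
by rewrite (hopf_antipr (hopf_laws H) x).
Qed.

Lemma sw_mul U (f : H -> H -> U) x y : bilinear_for *:%R *:%R f ->
  \sw_(a, b <- x * y) f a b =
  \sw_(a, b <- x) \sw_(c, d <- y) f (a * c) (b * d).
Proof.
move=> fb; rewrite [comul _](hopf_comulM (hopf_laws H) x y) /tmul.
rewrite (linear_tlift _ (tlift_linear fb)); apply: tlift_ext => a b.
rewrite (linear_tlift _ (tlift_linear fb)); apply: tlift_ext => c d.
by rewrite tlift_pure.
Qed.

Lemma sw_one U (f : H -> H -> U) : bilinear_for *:%R *:%R f ->
  \sw_(a, b <- 1) f a b = f 1 1.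
Proof.
by move=> fb; rewrite [comul 1](hopf_comul1 (hopf_laws H)) tlift_pure.
Qed.

Lemma counitM x y : counit (x * y) = counit x * counit y.
Proof. exact: (hopf_counitM (hopf_laws H)). Qed.

Lemma counit1 : counit (1 : H) = 1.
Proof. exact: (hopf_counit1 (hopf_laws H)). Qed.

Lemma counitZ a x : counit (a *: x) = a * counit x.
Proof. exact: (linZ (@lin_counit _ H)). Qed.

Lemma counitB x y : counit (x - y) = counit x - counit y.
Proof. exact: (linB (@lin_counit _ H)). Qed.

(** Apply the counit to S(x_1) x_2 = counit(x) 1; multiplicativity and the counit axiom collapse the
    left side to counit(S(x)). *)
Lemma counit_antip x : counit (antip x) = counit x.
Proof.
have := congr1 counit (hopf_antipl (hopf_laws H) x).
rewrite /= counitZ counit1 mulr1 => <-.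
rewrite [RHS](linear_tlift _ (@lin_counit _ H)).
rewrite -[LHS](@sw_counitr k^o (fun a => counit (antip a))); last by lin.
by apply: (@tlift_ext _ _ _ k^o) => a b; rewrite [RHS]counitM mulrC.
Qed.

(** This and the next three are the cancellation rules S(x_1) x_2 (x) x_3 = 1 (x) x, and its
    variants. In each, coassociativity brings the antipode next to its partner, and the antipode and
    counit axioms finish. *)
Lemma sw_antiplK U (f : H -> H -> U) x : bilinear_for *:%R *:%R f ->
  \sw_(a, b <- x) \sw_(b1, b2 <- b) f (antip a * b1) b2 = f 1 x.
Proof.
move=> fb; rewrite -(@sw_coassoc _ (fun a b c => f (antip a * b) c)); try lin.
under tlift_ext => a c.
  rewrite (@sw_antipl _ (fun z => f z c)); last by lin.
  over.
by rewrite sw_counitl //; lin.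
Qed.

Lemma sw_antiprK U (f : H -> H -> U) x : bilinear_for *:%R *:%R f ->
  \sw_(a, b <- x) \sw_(b1, b2 <- b) f (a * antip b1) b2 = f 1 x.
Proof.
move=> fb; rewrite -(@sw_coassoc _ (fun a b c => f (a * antip b) c)); try lin.
under tlift_ext => a c.
  rewrite (@sw_antipr _ (fun z => f z c)); last by lin.
  over.
by rewrite sw_counitl //; lin.
Qed.

Lemma sw_Kantipl U (f : H -> H -> U) x : bilinear_for *:%R *:%R f ->
  \sw_(a, b <- x) \sw_(a1, a2 <- a) f a1 (antip a2 * b) = f x 1.
Proof.
move=> fb; rewrite (@sw_coassoc _ (fun a b c => f a (antip b * c))); try lin.
under tlift_ext => a c.
  rewrite (@sw_antipl _ (fun z => f a z)); last by lin.
  over.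
by rewrite (@sw_counitr _ (fun a => f a 1)) //; lin.
Qed.

Lemma sw_Kantipr U (f : H -> H -> U) x : bilinear_for *:%R *:%R f ->
  \sw_(a, b <- x) \sw_(a1, a2 <- a) f a1 (a2 * antip b) = f x 1.
Proof.
move=> fb; rewrite (@sw_coassoc _ (fun a b c => f a (b * antip c))); try lin.
under tlift_ext => a c.
  rewrite (@sw_antipr _ (fun z => f a z)); last by lin.
  over.
by rewrite (@sw_counitr _ (fun a => f a 1)) //; lin.
Qed.

(** S(xy) = S(y_1) y_2 S(x y_3) = S(y_1) counit(y_2) S(x), the second equality by [step]. *)
Lemma antipM x y : antip (x * y) = antip y * antip x.
Proof.
(* Insert S(z_1) z_2 in front: S(z_1) z_2 y_1 S(z_3 y_2) contains the antipode identity for the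
   product z_2 y. *)
have step y' z :
  \sw_(c, d <- y') (c * antip (z * d)) = counit y' *: antip z.
  pose f b c := b * \sw_(p, q <- y') (p * antip (c * q)).
  have -> : \sw_(c, d <- y') (c * antip (z * d)) = f 1 z by rewrite /f mul1r.
  rewrite -(@sw_antiplK _ f); last by rewrite /f; lin.
  transitivity (\sw_(a, b <- z) (counit b *: (counit y' *: antip a))).
    apply: tlift_ext => a b; rewrite /f.
    have /(congr1 ( *%R (antip a))) := hopf_antipr (hopf_laws H) (b * y').
    rewrite /= sw_mul; last by lin.
    rewrite counitM -scalerAr mulr1 -scalerA => <-.
    rewrite [RHS](linear_tlift _ (lin_mulr _ (@lin_id _ _))).
    apply: tlift_ext => b1 b2; rewrite -mulrA; congr (_ * _).
    rewrite (linear_tlift _ (lin_mulr b1 (@lin_id _ _))).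
    by apply: tlift_ext => c d; rewrite mulrA.
  by rewrite (@sw_counitr _ (fun a => counit y' *: antip a)) //; lin.
have := @sw_antiplK _ (fun c d => c * antip (x * d)) y.
rewrite mul1r => <-; last by lin.
transitivity (\sw_(a, b <- y) (counit b *: (antip a * antip x))).
  apply: tlift_ext => a b; rewrite scalerAr -step.
  rewrite (linear_tlift _ (lin_mulr _ (@lin_id _ _))).
  by apply: tlift_ext => c d; rewrite mulrA.
by rewrite (@sw_counitr _ (fun a => antip a * antip x)) //; lin.
Qed.

End Sweedler.
(** * Slices of a tensor *)

Section Slices.
Variable k : fieldType.
Implicit Types U V W : lmodType k.

(** A chosen preimage need not be linear in w. Subtracting its component [r] in the kernel of [g]
    makes it so, since x - r x depends only on g x ([rE]). The projection [q] onto the image makes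
    it total. *)
Lemma linear_pinv V W (g : V -> W) : linear g ->
  exists2 s : W -> V, linear s & forall x, g (s (g x)) = g x.
Proof.
move=> gl.
have kerS : submod_closed [pred x | g x == 0].
  split=> [|a x y]; rewrite !inE ?(lin0 gl) // => /eqP gx /eqP gy.
  by rewrite gl gx gy scaler0 addr0.
have imS : submod_closed [pred w | `[< exists v, g v = w >]].
  split=> [|a x y]; rewrite !inE.
    by apply/asboolP; exists 0; apply: lin0.
  move=> /asboolP[v vx] /asboolP[w wy].
  by apply/asboolP; exists (a *: v + w); rewrite gl vx wy.
have [r [rl rker rK]] := linear_retraction kerS.
have [q [ql qim qK]] := linear_retraction imS.
have gr x : g (r x) = 0 by apply/eqP/rker.
have rE x y : g x = g y -> x - r x = y - r y.
  move=> gxy; have rxy : r x - r y = x - y.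
    by rewrite -(linB rl) rK // inE (linB gl) gxy subrr.
  by rewrite -[r x](subrK (r y)) rxy opprD addrA subKr.
have /choice[f fP] w : exists v, g v = q w by apply/asboolP/qim.
exists (fun w => f w - r (f w)) => [a x y|x].
  have -> : a *: (f x - r (f x)) + (f y - r (f y)) =
      (a *: f x + f y) - r (a *: f x + f y).
    by rewrite rl scalerBr opprD addrACA.
  by apply: rE; rewrite fP ql gl !fP.
rewrite (linB gl) gr subr0 fP qK // inE.
by apply/asboolP; exists x.
Qed.

(** A pseudo-inverse [s] of c |-> c v satisfies s(v) v = v, so it is the functional sought. *)
Lemma functional_eq1 V (v : V) : v != 0 ->
  exists2 phi : V -> k^o, linear phi & phi v = 1.
Proof.
move=> v0; have gl : linear (fun c : k^o => c *: v) by lin.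
have [s sl /(_ 1)] := linear_pinv gl.
rewrite scale1r => /eqP; rewrite -subr_eq0 -[X in _ - X]scale1r -scalerBl.
rewrite scaler_eq0 (negPf v0) orbF subr_eq0 => /eqP.
by exists s.
Qed.

(** Induction on the number of terms. If the first vector v is nonzero and phi(v) = 1, the vanishing
    slice along phi expresses w through the other terms. Substituting it replaces each other vector
    x by x - phi(x) v and removes the first term. *)
Lemma slices_eq0 V W (T : tens V W) :
  (forall phi : V -> k^o, linear phi -> tlift (fun v w => phi v *: w) T = 0) ->
  T = 0.
Proof.
rewrite [T]tens_sum; move: (tens_repr T) => s {T}.
have [n] := ubnP (size s); elim: n s => // n IHn [|[v w] s] /= sn sl0.
  by rewrite big_nil.
have t0 z : (0 : V) \ox z = 0 by rewrite (lin0 (lin_tpurel z (@lin_id _ _))).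
have [v0|/functional_eq1[phi phil phi1]] := eqVneq v 0.
  have TE : \sum_(p <- (v, w) :: s) p.1 \ox p.2 = \sum_(p <- s) p.1 \ox p.2.
    by rewrite big_cons /= v0 t0 add0r.
  by move: sl0; rewrite TE; apply: IHn.
pose rho x := x - phi x *: v.
have rhol : linear rho by rewrite /rho; lin.
have TE : \sum_(p <- (v, w) :: s) p.1 \ox p.2 =
    \sum_(p <- [seq (rho q.1, q.2) | q <- s]) p.1 \ox p.2.
  have := sl0 phi phil; rewrite tlift_sum; last by lin.
  move/(congr1 (tpure v)).
  rewrite (Defs.linear_sum (lin_tpurer v (@lin_id _ _))).
  rewrite (lin0 (lin_tpurer v (@lin_id _ _))) => vs0.
  rewrite -[LHS]subr0 -[X in _ - X]vs0 -sumrB big_cons big_map /=.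
  rewrite phi1 scale1r subrr add0r; apply: eq_bigr => -[x y] _ /=.
  rewrite (linB (lin_tpurel y (@lin_id _ _))); congr (_ - _).
  rewrite (linZ (lin_tpurel y (@lin_id _ _))).
  by rewrite (linZ (lin_tpurer v (@lin_id _ _))).
by move: sl0; rewrite TE; apply: IHn; rewrite size_map.
Qed.

(* The slices of T form a submodule Y with T in V (x) Y; the hypothesis makes Y
   stable under every F x, and [tlift F T] is a sum of elements F x y, y in
   Y. *)
Lemma slice_of_stable V W (T : tens V W) (F : V -> W -> W) :
  bilinear_for *:%R *:%R F ->
  (forall x, exists2 h : V -> V, linear h & tmap id (F x) T = tmap h id T) ->
  exists2 phi : V -> k^o, linear phi &
    tlift (fun v w => phi v *: w) T = tlift F T.
Proof.
move=> Fb Fh.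
pose Y := [pred w | `[< exists2 phi : V -> k^o, linear phi &
    tlift (fun v w => phi v *: w) T = w >]].
have YS : submod_closed Y.
  split=> [|a x y]; rewrite !inE.
    apply/asboolP; exists (fun=> 0) => [a x y|]; first by rewrite scaler0 addr0.
    by rewrite /tlift big1 // => p _; rewrite scale0r.
  move=> /asboolP[f fl <-] /asboolP[g gl <-].
  apply/asboolP; exists (fun v => a *: f v + g v); first by lin.
  rewrite /tlift scaler_sumr -big_split; apply: eq_bigr => p _ /=.
  by rewrite scalerDl scalerA.
have [r [rl rY rK]] := linear_retraction YS.
(* This says that T lies in V (x) Y: each slice of T is fixed by the retraction [r] onto Y. *)
have T0 : tmap id (fun w => w - r w) T = 0.
  have ql : linear (fun w => w - r w) by lin.
  apply: slices_eq0 => phi phil; rewrite tlift_tmap //; last by lin.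
  transitivity (tlift (fun v w => phi v *: w) T
                - r (tlift (fun v w => phi v *: w) T)).
    rewrite (linear_tlift _ rl) /tlift -sumrB; apply: eq_bigr => p _.
    by rewrite (linZ rl) scalerBr.
  by rewrite rK ?subrr // inE; apply/asboolP; exists phi.
apply/asboolP; rewrite -[asbool _]/(_ \in Y).
have -> : tlift F T = tlift (fun v w => F v (r w)) T.
  apply/eqP; rewrite -subr_eq0; apply/eqP.
  rewrite -[RHS](lin0 (tlift_linear Fb)) -T0 tlift_tmap //; last by lin.
  by rewrite /tlift -sumrB; apply: eq_bigr => p _; rewrite (linB (Fb.2 _)).
rewrite /tlift; elim/big_ind: _ => [|x y xY yY|p _].
- exact: YS.1.
- by rewrite -[x]scale1r; apply: YS.2.
(* If [r p.2] is the slice along phi, then its image under [F p.1] is the slice along phi \o h, by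
   [hE]. *)
have /asboolP[phi phil <-] := rY p.2; have [h hl hE] := Fh p.1.
apply/asboolP; exists (phi \o h); first exact: lin_comp.
rewrite (linear_tlift _ (Fb.2 _)).
have pl : bilinear_for *:%R *:%R (fun v (w : W) => phi v *: w) by lin.
have := congr1 (tlift (fun v w => phi v *: w)) hE.
rewrite !tlift_tmap //; last exact: Fb.2.
move=> <-; apply: tlift_ext => v w; rewrite (linZ (Fb.2 _)) //.
Qed.

End Slices.
(** * Integrals *)

Section Integral.
Variables (k : fieldType) (B : hopfAlg k).

Definition normalized_integral (t : B) : Prop :=
  [/\ counit t = 1, forall x, x * t = counit x *: t
    & forall x, t * x = counit x *: t].

(** Compute t y in two ways, by the left invariance of y and by the right invariance of t. *)
Lemma integral_unique t y : normalized_integral t ->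
  (forall x, x * y = counit x *: y) -> y = counit y *: t.
Proof. by move=> [t1 _ tr] yl; rewrite -tr yl t1 scale1r. Qed.

(* A left integral x with counit x = 0 spans a left ideal of square 0, which a
   complement in the semisimple ring B forces to vanish. *)
Lemma semisimple_integral :
  semisimple_ring B -> exists t, normalized_integral t.
Proof.
move=> ssB.
have nil0 (x : B) :
    (forall b : B, b * x = counit b *: x) -> counit x = 0 -> x = 0.
  move=> xl x0; pose N := [pred y : B^o | `[< exists c : k, y = c *: x :> B >]].
  have NS : submod_closed N.
    split=> [|a y z]; rewrite !inE.
      by apply/asboolP; exists 0; rewrite scale0r.
    move=> /asboolP[c ->] /asboolP[d ->]; apply/asboolP.
    exists (c * counit a + d); rewrite scalerDl -scalerA -xl.
    by rewrite -[a *: _]/(a * _) scalerAr.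
  have [N' [N'S NN' dec]] := ssB N NS.
  have [y [z [/asboolP[c ->] N'z one]]] := dec 1.
  have xz : x = x * z.
    rewrite -[LHS]mulr1 one mulrDr -scalerAr xl x0 scale0r scaler0 add0r //.
  apply: NN'; first by apply/asboolP; exists 1; rewrite scale1r.
  by rewrite xz -[_ * _]addr0; apply: N'S.2 => //; apply: N'S.1.
(* The integral is the component of 1 in a complement N' of the augmentation ideal: x t - counit(x)
   t lies in both N and N'. *)
pose N := [pred y : B^o | counit (y : B) == 0].
have NS : submod_closed N.
  split=> [|a y z]; rewrite !inE; first by rewrite (lin0 (@lin_counit _ B)).
  move=> /eqP y0 /eqP z0; rewrite (linD (@lin_counit _ B)) z0 addr0.
  by rewrite -[a *: y]/(a * y) counitM y0 mulr0.
have [N' [N'S NN' dec]] := ssB N NS.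
have [y [t [/eqP y0 N't one]]] := dec 1.
have t1 : counit (t : B) = 1.
  by rewrite -(counit1 B) [in RHS]one (linD (@lin_counit _ B)) y0 add0r.
have tl (x : B) : x * t = counit x *: t.
  apply/eqP; rewrite -subr_eq0; apply/eqP/NN'.
    by rewrite inE counitB counitM counitZ t1 !mulr1 subrr.
  rewrite -[counit x *: _]mulr_algl -mulrBl -[_ * _]addr0.
  by apply: N'S.2 => //; apply: N'S.1.
(* For right invariance, t x - counit(x) t is a left integral of counit 0, hence vanishes by
   [nil0]. *)
exists t; split=> // x; apply/eqP; rewrite -subr_eq0; apply/eqP/nil0 => [b|].
  by rewrite mulrBr mulrA tl -scalerAr tl scalerBr -scalerAl !scalerA mulrC.
by rewrite counitB counitM counitZ t1 mul1r mulr1 subrr.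
Qed.

Variable u : B.
Hypothesis uI : normalized_integral u.

(** Write 1 (x) a as S(a_1) a_2 (x) a_3; then a_2 u_1 (x) a_3 u_2 is the comultiplication of a_2 u =
    counit(a_2) u. *)
Lemma integral_antipl (U : lmodType k) (f : B -> B -> U) a :
  bilinear_for *:%R *:%R f ->
  \sw_(x, y <- u) f x (a * y) = \sw_(x, y <- u) f (antip a * x) y.
Proof.
move=> fb; pose G b c := \sw_(x, y <- u) f (b * x) (c * y).
transitivity (G 1 a); first by apply: tlift_ext => x y; rewrite mul1r.
rewrite -sw_antiplK; last by rewrite /G; lin.
pose G' b := \sw_(x, y <- u) f (antip b * x) y.
rewrite -[RHS](@sw_counitr _ _ _ G'); last by rewrite /G'; lin.
apply: tlift_ext => b c; have [_ ul _] := uI.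
transitivity (\sw_(x, y <- c * u) f (antip b * x) y); last first.
  rewrite ul -/(G' b); pose h z := \sw_(x, y <- z) f (antip b * x) y.
  by apply: (linZ (f := h)); rewrite /h; lin.
rewrite sw_mul; last by lin.
by apply: tlift_ext => b1 b2; apply: tlift_ext => x y; rewrite mulrA.
Qed.

(** Mirror image: a (x) 1 = a_1 (x) a_2 S(a_3), and u a_1 = counit(a_1) u. *)
Lemma integral_antipr (U : lmodType k) (f : B -> B -> U) a :
  bilinear_for *:%R *:%R f ->
  \sw_(x, y <- u) f (x * a) y = \sw_(x, y <- u) f x (y * antip a).
Proof.
move=> fb; pose G b c := \sw_(x, y <- u) f (x * b) (y * c).
transitivity (G a 1); first by apply: tlift_ext => x y; rewrite mulr1.
rewrite -sw_Kantipr; last by rewrite /G; lin.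
pose G' b := \sw_(x, y <- u) f x (y * antip b).
rewrite -[RHS](@sw_counitl _ _ _ G'); last by rewrite /G'; lin.
apply: tlift_ext => c b; have [_ _ ur] := uI.
transitivity (\sw_(x, y <- u * c) f x (y * antip b)); last first.
  rewrite ur -/(G' b); pose h z := \sw_(x, y <- z) f x (y * antip b).
  by apply: (linZ (f := h)); rewrite /h; lin.
rewrite sw_mul; last by lin.
rewrite tlift_exchange.
by apply: tlift_ext => x y; apply: tlift_ext => b1 b2; rewrite mulrA.
Qed.

End Integral.

(** The hypotheses say that ker g is a Hopf ideal: the lemmas below are about
    the quotient Hopf algebra g(B), with integral g u. *)
Section Frobenius.
Variables (k : fieldType) (B : hopfAlg k) (u : B) (W : lmodType k) (g : B -> W).
Hypothesis uI : normalized_integral u.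
Hypothesis gl : linear g.
Hypothesis g_ideall : forall x y, g x = 0 -> g (y * x) = 0.
Hypothesis g_idealr : forall x y, g x = 0 -> g (x * y) = 0.
Hypothesis g_antip : forall x, g x = 0 -> g (antip x) = 0.
Hypothesis g_comul : forall x, g x = 0 -> tmap g g (comul x) = 0.

(** [W] carries no multiplication. These three facts let the product and antipode descend to the
    image of [g], computed through any section [s]. *)
Let eql x y z : g x = g y -> g (z * x) = g (z * y).
Proof.
move=> gxy; apply/eqP; rewrite -subr_eq0 -(linB gl) -mulrBr g_ideall //.
by rewrite (linB gl) gxy subrr.
Qed.

Let eqr x y z : g x = g y -> g (x * z) = g (y * z).
Proof.
move=> gxy; apply/eqP; rewrite -subr_eq0 -(linB gl) -mulrBl g_idealr //.
by rewrite (linB gl) gxy subrr.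
Qed.

Let eqS x y : g x = g y -> g (antip x) = g (antip y).
Proof.
move=> gxy; apply/eqP; rewrite -subr_eq0 -(linB gl) -(linB (@lin_antip _ B)).
by rewrite g_antip // (linB gl) gxy subrr.
Qed.

(** Take T = g u_1 (x) g u_2 and let F x y stand for S(x) y in the quotient. By [integral_antipl], F
    x on the second factor of T is multiplication by S(S(x)) on the first, so [slice_of_stable]
    makes g(S(u_1) u_2) = g 1 a slice of T. *)
Lemma frobenius_left : exists2 phi : W -> k^o, linear phi &
  \sw_(a, b <- u) (phi (g a) *: g b) = g 1.
Proof.
have [s sl sK] := linear_pinv gl.
pose F x y := g (antip (s x) * s y).
have Fb : bilinear_for *:%R *:%R F by rewrite /F; lin.
have [x|phi phil phiE] := slice_of_stable (T := tmap g g (comul u)) Fb.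
  exists (fun w => g (antip (antip (s x)) * s w)); first by lin.
  rewrite !tmap_tmap //; try lin.
  transitivity (\sw_(a, b <- u) (g a \ox g (antip (s x) * b))).
    by apply: tlift_ext => a b; congr (_ \ox _); apply/eql/sK.
  rewrite (integral_antipl uI _ (f := fun a b => g a \ox g b)); last by lin.
  by apply: tlift_ext => a b; congr (_ \ox _); apply/esym/eql/sK.
exists phi => //; move: phiE; rewrite !tlift_tmap //; try lin.
move=> ->; have [u1 _ _] := uI.
rewrite -[RHS]scale1r -u1 -(sw_antipl _ gl); apply: tlift_ext => a b.
by rewrite /F; apply: etrans (eqr _ (eqS (sK _))) _; apply/eql/sK.
Qed.

(** The same argument for the flipped tensor g u_2 (x) g u_1, with y S(x) for F and the identity u_1
    S(u_2) = 1. *)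
Lemma frobenius_right : exists2 psi : W -> k^o, linear psi &
  \sw_(a, b <- u) (psi (g b) *: g a) = g 1.
Proof.
have [s sl sK] := linear_pinv gl.
pose F x y := g (s y * antip (s x)).
have Fb : bilinear_for *:%R *:%R F by rewrite /F; lin.
have [x|phi phil] := slice_of_stable (T := \sw_(a, b <- u) (g b \ox g a)) Fb.
  exists (fun w => g (s w * antip (antip (s x)))); first by lin.
  have hl : linear (fun w => g (s w * antip (antip (s x)))) by lin.
  have Fxl : linear (F x) by lin.
  rewrite (linear_tlift _ (tmap_linear (@lin_id _ _) Fxl)).
  rewrite (linear_tlift _ (tmap_linear hl (@lin_id _ _))).
  transitivity (\sw_(a, b <- u) (g b \ox g (a * antip (s x)))).
    apply: tlift_ext => a b; rewrite tmap_pure //; congr (_ \ox _).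
    exact/eqr/sK.
  rewrite (integral_antipr uI _ (f := fun a b => g b \ox g a)); last by lin.
  apply: tlift_ext => a b; rewrite tmap_pure //; congr (_ \ox _).
  exact/esym/eqr/sK.
have pb : bilinear_for *:%R *:%R (fun v (w : W) => phi v *: w) by lin.
rewrite (linear_tlift _ (tlift_linear pb)) (linear_tlift _ (tlift_linear Fb)).
move=> phiE; exists phi => //; have [u1 _ _] := uI.
rewrite -[RHS]scale1r -u1 -(sw_antipr _ gl).
transitivity (\sw_(a, b <- u) (tlift (fun v w => phi v *: w) (g b \ox g a))).
  by apply: tlift_ext => a b; rewrite tlift_pure.
rewrite phiE; apply: tlift_ext => a b; rewrite tlift_pure //.
by rewrite /F; apply: etrans (eqr _ (sK _)) _; apply/eql/eqS/sK.
Qed.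

(** The functional phi of [frobenius_left] is an integral on the quotient. The defect [D] is first
    shown to vanish against g u_2 in D(u_1) (x) g u_2, and the dual functional psi then propagates
    this to every element. *)
Lemma frobenius_integral : exists2 phi : W -> k^o, linear phi &
  \sw_(a, b <- u) (phi (g a) *: g b) = g 1 /\
  forall x, \sw_(a, b <- x) (phi (g a) *: g b) = phi (g x) *: g 1.
Proof.
have [phi phil phiE] := frobenius_left.
have [psi psil psiE] := frobenius_right.
have [s sl sK] := linear_pinv gl.
exists phi => //; split=> // a.
pose D x := \sw_(a, b <- x) (phi (g a) *: g b) - phi (g x) *: g 1.
have Dl : linear D by rewrite /D; lin.
have D0 x : g x = 0 -> D x = 0.
  move=> gx; rewrite /D gx (lin0 phil) scale0r subr0.
  pose h := tlift (fun v w : W => phi v *: w).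
  have hl : linear h by rewrite /h; lin.
  rewrite -[RHS](lin0 hl) -(g_comul gx) /h tlift_tmap //; last by lin.
have Deq x y : g x = g y -> D x = D y.
  move=> gxy; apply/eqP; rewrite -subr_eq0 -(linB Dl) D0 //.
  by rewrite (linB gl) gxy subrr.
(* D(u_1) (x) g u_2 is the image under g (x) g of the comultiplication of phi(g u_1) u_2, minus g 1
   (x) g 1. *)
have Du (U : lmodType k) (f : W -> W -> U) : bilinear_for *:%R *:%R f ->
    \sw_(x, y <- u) f (D x) (g y) = 0.
  move=> fb; pose h x := \sw_(b, c <- x) f (g b) (g c).
  have hl : linear h by rewrite /h; lin.
  have hT x : h x = tlift f (tmap g g (comul x)) by rewrite tlift_tmap.
  (* [h] depends only on the class modulo ker g, by [g_comul], and phi(g u_1) u_2 has the same class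
     as 1. *)
  have hu : h (\sw_(x, y <- u) (phi (g x) *: y)) = f (g 1) (g 1).
    rewrite -[RHS](@sw_one _ B _ (fun b c => f (g b) (g c))); last by lin.
    apply/eqP; rewrite -subr_eq0 -/(h 1) -(linB hl) hT g_comul.
      by rewrite (lin0 (tlift_linear fb)).
    rewrite (linB gl) (linear_tlift _ gl) -phiE; apply/eqP; rewrite subr_eq0.
    by apply/eqP/tlift_ext => x y; rewrite (linZ gl).
  transitivity (h (\sw_(x, y <- u) (phi (g x) *: y)) - f (g 1) (g 1)).
    rewrite (linear_tlift _ hl) -{2}phiE.
    rewrite (linear_tlift _ (fb.2 _)) /h.
    transitivity (\sw_(x, y <- u) \sw_(b, c <- x) f (phi (g b) *: g c) (g y) -
      \sw_(x, y <- u) f (phi (g x) *: g 1) (g y)).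
      rewrite /tlift -sumrB; apply: eq_bigr => p _.
      rewrite (linB (fb.1 _)); congr (_ - _).
      exact: (linear_tlift _ (fb.1 _)).
    congr (_ - _); last first.
      apply: tlift_ext => x y.
      by rewrite (linZ (fb.1 _)) (linZ (fb.2 _)).
    rewrite (@sw_coassoc _ _ _ (fun b c y => f (phi (g b) *: g c) (g y)));
      try lin.
    apply: tlift_ext => x y; rewrite -/(h y) -/(h (_ *: y)) (linZ hl) /h.
    rewrite [RHS](linear_tlift _ (lin_scaler _ (@lin_id _ _))).
    by apply: tlift_ext => b c; rewrite (linZ (fb.1 _)).
  by rewrite hu subrr.
apply/eqP; rewrite -subr_eq0 -/(D a).
(* Modulo ker g, 1 = psi(g u_2) u_1. Then D(a) = psi(g u_2) D(u_1 a) = psi(g(u_2 S(a))) D(u_1),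
   which is 0 by [Du]. *)
have <- : D ((\sw_(x, y <- u) (psi (g y) *: x)) * a) = D a.
  apply: Deq; rewrite -[a in RHS]mul1r; apply: eqr.
  rewrite -psiE (linear_tlift _ gl).
  by apply: tlift_ext => x y; rewrite (linZ gl).
rewrite (linear_tlift _ (lin_comp Dl (lin_mull a (@lin_id _ _)))).
apply/eqP; transitivity (\sw_(x, y <- u) (psi (g y) *: D (x * a))).
  by apply: tlift_ext => x y; rewrite -scalerAl (linZ Dl).
rewrite (integral_antipr uI _ (f := fun x y => psi (g y) *: D x)); last by lin.
have := Du _ (fun v w => psi (g (s w * antip a)) *: v).
move=> <-; last by lin.
by apply: tlift_ext => x y; congr (psi _ *: _); apply/esym/eqr/sK.
Qed.

End Frobenius.
(** * The integral of a normal Hopf subalgebra *)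

Section NormalIntegral.
Variables (k : fieldType) (H : hopfAlg k).

Lemma sw_val (A : hopfSub H) (U : lmodType k) (f : H -> H -> U) (x : hsub A) :
  bilinear_for *:%R *:%R f ->
  \sw_(a, b <- val x) f a b =
  tlift (fun a b => f (val a) (val b)) (sub_comul x).
Proof.
move=> fb; rewrite -sub_comulE tlift_tmap //; exact: hsub_val_linear.
Qed.

(** h_1 a S(h_2) h_3 = h a: the commutation rule that the smash product multiplication encodes. *)
Lemma mul_adjl (h a : H) : \sw_(h1, h2 <- h) (adjl h1 a * h2) = h * a.
Proof.
have := @sw_Kantipl _ H _ (fun b c => b * a * c) h.
rewrite mulr1 => <-; last by lin.
apply: tlift_ext => h1 h2; rewrite (linear_tlift _ (lin_mull h2 (@lin_id _ _))).
by apply: tlift_ext => b c; rewrite mulrA.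
Qed.

(** h_1 S(h_2) a h_3 = a h: this carries an element of a normal A across h while remaining in A. *)
Lemma mul_adjr (h a : H) : \sw_(h1, h2 <- h) (h1 * adjr h2 a) = a * h.
Proof.
have := @sw_antiprK _ H _ (fun b c => b * a * c) h.
rewrite mul1r => <-; last by lin.
apply: tlift_ext => h1 h2; rewrite (linear_tlift _ (lin_mulr h1 (@lin_id _ _))).
by apply: tlift_ext => b c; rewrite !mulrA.
Qed.

Lemma counit_adjl (h a : H) : counit (adjl h a) = counit h * counit a.
Proof.
rewrite -[counit h](@sw_counitr _ _ k^o (fun x => counit x) h); last by lin.
rewrite [LHS](linear_tlift _ (@lin_counit _ H)).
rewrite [RHS](linear_tlift _ (lin_mull (B := k^o) (counit a) (@lin_id _ _))).
apply: (@tlift_ext _ _ _ k^o) => b c; rewrite !counitM counit_antip.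
by rewrite -[_ *: _]/(_ * _) mulrC mulrA.
Qed.

Lemma counit_adjr (h a : H) : counit (adjr h a) = counit h * counit a.
Proof.
rewrite -[counit h](@sw_counitr _ _ k^o (fun x => counit x) h); last by lin.
rewrite [LHS](linear_tlift _ (@lin_counit _ H)).
rewrite [RHS](linear_tlift _ (lin_mull (B := k^o) (counit a) (@lin_id _ _))).
apply: (@tlift_ext _ _ _ k^o) => b c; rewrite !counitM counit_antip.
by rewrite -[_ *: _]/(_ * _) mulrC mulrA.
Qed.

Variables (A : hopfSub H) (nA : normal_hopf A) (t : hsub A).
Hypothesis tI : normalized_integral (t : sub_hopfAlg A).

Lemma val_integrall a : a \in A -> a * val t = counit a *: val t.
Proof.
move=> Aa; have [_ /(_ (exist _ a Aa : hsub A)) /(congr1 val)] := tI.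
by [].
Qed.

Lemma val_integralr a : a \in A -> val t * a = counit a *: val t.
Proof.
move=> Aa; have [_ _ /(_ (exist _ a Aa : hsub A)) /(congr1 val)] := tI.
by [].
Qed.

(** The element h.t of A is again a left integral: for b in A, [mul_adjr] turns b h_1 t S(h_2) into
    h_1 b' t S(h_3) with b' = S(h_2)_1 b h_2 read as [adjr h2 b] in A, and t absorbs b'. Uniqueness
    and the counit give the scalar. *)
Lemma adjl_integral h : adjl h (val t) = counit h *: val t.
Proof.
have At := valP t; have Ax := nA.1 h _ At.
pose x : hsub A := exist (fun y => y \in hsub_pred A) _ Ax.
have xl b : (b : sub_hopfAlg A) * x = counit (b : sub_hopfAlg A) *: x.
  apply: val_inj; rewrite -[LHS]/(val b * adjl h (val t)).
  rewrite -[RHS]/(counit (val b) *: adjl h (val t)).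
  rewrite [LHS](linear_tlift _ (lin_mulr _ (@lin_id _ _))).
  transitivity (\sw_(x, y <- h)
      (\sw_(x1, x2 <- x) (x1 * adjr x2 (val b)) * val t * antip y)).
    by apply: tlift_ext => y z; rewrite mul_adjr !mulrA.
  rewrite [RHS](linear_tlift _ (lin_scaler _ (@lin_id _ _))).
  apply: tlift_ext => y z; rewrite !scalerAl; congr (_ * _).
  rewrite (linear_tlift _ (lin_mull _ (@lin_id _ _))).
  rewrite -[in RHS](@sw_counitr _ _ _ id y) //.
  rewrite (linear_tlift _ (lin_scaler _ (@lin_id _ _))).
  rewrite (linear_tlift _ (lin_mull _ (@lin_id _ _))).
  apply: tlift_ext => y1 y2; rewrite -mulrA val_integrall; last first.
    exact/nA.2/valP.
  by rewrite counit_adjr -scalerAr !scalerAl scalerA mulrC.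
have := congr1 val (integral_unique tI xl); rewrite /= => ->.
rewrite counit_adjl; have [t1 _ _] := tI.
by rewrite -[counit (val t)]/(counit (t : sub_hopfAlg A)) t1 mulr1.
Qed.

(** h t = (h_1 . t) h_2 = counit(h_1) t h_2 = t h. *)
Lemma integral_central h : h * val t = val t * h.
Proof.
rewrite -mul_adjl -[in RHS](@sw_counitl _ _ _ id h) //.
rewrite [RHS](linear_tlift _ (lin_mulr _ (@lin_id _ _))).
by apply: tlift_ext => a b; rewrite adjl_integral -scalerAl scalerAr.
Qed.

End NormalIntegral.

(** * Dual functional of an integral, and injectivity of the antipode *)

Section TrivialIdeal.
Variables (k : fieldType) (B : hopfAlg k) (u : B).
Hypothesis uI : normalized_integral u.

Lemma integral_dual : exists2 psi : B -> k^o, linear psi &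
  \sw_(a, b <- u) (psi b *: a) = 1.
Proof.
have [] := @frobenius_right k B u B id uI; rewrite /=.
- exact: lin_id.
- by move=> x y ->; rewrite mulr0.
- by move=> x y ->; rewrite mul0r.
- by move=> x ->; exact: (lin0 (@lin_antip _ B)).
- by move=> psi psil psiE; exists psi.
Qed.

(** x = psi(u_2) u_1 x = psi(u_2 S(x)) u_1 by [integral_antipr]. *)
Lemma antip_eq0 (x : B) : antip x = 0 -> x = 0.
Proof.
move=> Sx; have [psi psil psiE] := integral_dual.
rewrite -[x]mul1r -psiE (linear_tlift _ (lin_mull x (@lin_id _ _))).
transitivity (\sw_(a, b <- u) (psi b *: (a * x))).
  by apply: tlift_ext => a b; rewrite scalerAl.
rewrite (integral_antipr uI _ (f := fun a b => psi b *: a)); last by lin.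
by rewrite /tlift big1 // => p _; rewrite Sx mulr0 (lin0 psil) scale0r.
Qed.

End TrivialIdeal.

(** * Coinvariants *)

Section Intersection.
Variables (k : fieldType) (H : hopfAlg k) (A L : hopfSub H).
Hypothesis nA : normal_hopf A.
Variables (t : hsub A) (u : hsub L).
Hypothesis tI : normalized_integral (t : sub_hopfAlg A).
Hypothesis uI : normalized_integral (u : sub_hopfAlg L).
Hypothesis capAL : forall x : H, x \in A -> x \in L -> exists c : k, x = c%:A.

(* The assumption reads t l_1 (x) l_2 = t (x) l: the image of l in H / H A^+ is
   coinvariant. Applying comul (x) id and then x (x) y (x) z |-> x (x) y S(z)
   gives t_1 l (x) t_2 = t_1 (x) t_2 S(l), and a functional psi with
   psi(t_2) t_1 = 1 yields l. *)
Lemma coinvariant_mem (l : H) :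
  (forall (U : lmodType k) (f : H -> H -> U), bilinear_for *:%R *:%R f ->
    \sw_(a, b <- l) f (val t * a) b = f (val t) l) ->
  l \in A.
Proof.
move=> lco; have [psi' psil' psiE'] := integral_dual tI.
(* The functional psi' lives on A only; the retraction extends it to H, where y S(c) lies. *)
have [r rl rK] := hsub_retraction A.
pose psi x : k^o := psi' (r x).
have psil : linear psi by apply: lin_comp.
have psiE : \sw_(x, y <- val t) (psi y *: x) = 1.
  rewrite sw_val; last by lin.
  transitivity (val (\sw_(x, y <- (t : sub_hopfAlg A)) (psi' y *: x) : hsub A)).
    rewrite (linear_tlift _ (@hsub_val_linear _ _ A)).
    by apply: tlift_ext => a b; rewrite /psi rK.
  by rewrite psiE'.
pose f b c := \sw_(x, y <- b) (psi (y * antip c) *: x).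
have fb : bilinear_for *:%R *:%R f by rewrite /f; lin.
have <- : f (val t) l = l.
  rewrite -lco // -[RHS]mul1r -psiE.
  rewrite [RHS](linear_tlift _ (lin_mull l (@lin_id _ _))).
  transitivity (\sw_(x, y <- val t) \sw_(a, c <- l) \sw_(a1, a2 <- a)
      (psi (y * (a2 * antip c)) *: (x * a1))).
    rewrite tlift_exchange; apply: tlift_ext => a c.
    rewrite /f sw_mul; last by lin.
    by apply: tlift_ext => x y; apply: tlift_ext => a1 a2; rewrite mulrA.
  apply: tlift_ext => x y.
  rewrite (@sw_Kantipr _ H _ (fun a b => psi (y * b) *: (x * a))); last by lin.
  by rewrite mulr1 scalerAl.
(* The value is a combination of the first legs t_1, which lie in A. *)
rewrite /f sw_val; last by lin.
have <- := linear_tlift (fun a b : hsub A => (psi (val b * antip l) : k) *: a)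
  (@hsub_val_linear _ _ A) (sub_comul t).
exact: valP.
Qed.

Let tc := integral_central nA tI.

Let tl (a : H) : a \in A -> a * val t = counit a *: val t.
Proof. exact: val_integrall. Qed.

Let t1 : counit (val t) = 1.
Proof. by have [] := tI. Qed.

Let g (l : hsub L) : H := val l * val t.

Let gl : linear g.
Proof. rewrite /g; lin. Qed.

(** Multiply both factors of the comultiplication of x t = 0 by t: x_1 t_1 t (x) x_2 t_2 t = x_1 t
    (x) x_2 t, since t absorbs t_1 and t_2 with total counit 1. *)
Let g_comul (x : hsub L) : g x = 0 -> tmap g g (sub_comul x) = 0.
Proof.
move=> gx; pose m (h : H) := h * val t.
have ml : linear m by rewrite /m; lin.
have -> : tmap g g (sub_comul x) = \sw_(a, b <- val x) (m a \ox m b).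
  by rewrite sw_val //; lin.
transitivity (\sw_(a, b <- val x * val t) (m a \ox m b)); last first.
  pose h := tmap m m; have hl : linear h by rewrite /h; lin.
  by rewrite -[LHS]/(h (comul (g x))) gx (lin0 (@lin_comul _ H)) (lin0 hl).
rewrite sw_mul; last by lin.
apply: tlift_ext => a b; rewrite sw_val; last by lin.
have -> : m a \ox m b = tlift (fun c d =>
    counit (val c) *: (counit (val d) *: (m a \ox m b))) (sub_comul t).
  rewrite -(@sw_val _ _ A _
    (fun c d => counit c *: (counit d *: (m a \ox m b))) t); last by lin.
  rewrite (@sw_counitl _ H _ (fun c => counit c *: (m a \ox m b))); last by lin.
  by rewrite t1 scale1r.
apply: tlift_ext => c d; rewrite /m -!mulrA (tl (valP c)) (tl (valP d)).
rewrite -!scalerAr.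
rewrite (linZ (lin_tpurel _ (@lin_id _ _))).
by rewrite (linZ (lin_tpurer _ (@lin_id _ _))).
Qed.

Lemma mul_integral_eq0 (l : hsub L) : val l * val t = 0 -> l = 0.
Proof.
move=> lt0.
have [] := @frobenius_integral k (sub_hopfAlg L) u H g uI gl.
- move=> x y gx; rewrite /g -[X in X * _]/(val y * val x).
  by rewrite -mulrA [_ * val t]gx mulr0.
- move=> x y gx; rewrite /g -[X in X * _]/(val x * val y).
  by rewrite -mulrA tc mulrA [_ * val t]gx mul0r.
- move=> x gx; rewrite /g -[val (antip x)]/(antip (val x)).
  (* As t = t S(t), centrality gives S(x) t = t S(t) S(x) = t S(x t). *)
  rewrite tc; have -> : val t = val t * antip (val t).
    rewrite (val_integralr tI); last exact/hsub_antip/valP.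
    by rewrite counit_antip t1 scale1r.
  by rewrite -mulrA -antipM [val x * _]gx (lin0 (@lin_antip _ H)) mulr0.
- exact: g_comul.
move=> phi phil [phiu phiL].
pose z : hsub L :=
  tlift (fun a b : hsub L => (phi (g a) : k) *: b) (sub_comul u).
have zt : val z * val t = val t.
  rewrite -[RHS]mul1r -[RHS]/(g 1) -phiu -/(g z) (linear_tlift _ gl).
  by apply: tlift_ext => a b; rewrite (linZ gl).
have Az : val z \in A.
  (* With z = phi(g u_1) u_2, the tensor t z_1 (x) z_2 is phi(g u_1) g u_2 (x) u_3, and [phiL] turns
     it into t (x) z. *)
  apply: coinvariant_mem => U f fb.
  pose h (x : hsub L) := \sw_(a, b <- val x) f (val t * a) b.
  have hl : linear h by rewrite /h; lin.
  rewrite -/(h z) (linear_tlift _ hl) (linear_tlift _ (@hsub_val_linear _ _ L)).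
  rewrite (linear_tlift _ (fb.2 _)).
  pose F (a b c : sub_hopfAlg L) : U :=
    phi (g a) *: f (val t * val (b : hsub L)) (val (c : hsub L)).
  transitivity (\sw_(a, c <- (u : sub_hopfAlg L)) \sw_(c1, c2 <- c) F a c1 c2).
    apply: tlift_ext => a b; rewrite (linZ hl) /h sw_val; last by lin.
    by rewrite (linear_tlift _ (lin_scaler _ (@lin_id _ _))).
  rewrite -sw_coassoc /F; try lin.
  apply: tlift_ext => a c.
  rewrite (linZ (hsub_val_linear (A := L))) (linZ (fb.2 _)).
  rewrite -(linZ (fb.1 _)) -[in RHS](mul1r (val t)) -[1 * val t]/(g 1) -phiL.
  rewrite (linear_tlift _ (fb.1 _)); apply: tlift_ext => b b'.
  by rewrite (linZ (fb.1 _)) /F -tc.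
(* z is a scalar c, and the counit of z t = t forces c = 1. *)
have z1 : z = 1.
  have [c zc] := capAL Az (valP z); apply: val_inj; rewrite zc.
  have := congr1 counit zt; rewrite zc -scalerAl mul1r counitZ t1 mulr1 => ->.
  by rewrite scale1r.
apply: (antip_eq0 uI); rewrite -[LHS]mul1r -z1.
rewrite /z (linear_tlift _ (lin_mull _ (@lin_id _ _))).
transitivity (\sw_(a, b <- (u : sub_hopfAlg L))
    (phi (g a) *: (b * antip (l : sub_hopfAlg L)))).
  by apply: tlift_ext => a b; rewrite scalerAl.
rewrite -(integral_antipr uI _ (f := fun a b => phi (g a) *: b)); last by lin.
rewrite /tlift big1 // => p _; rewrite /g -[X in X * _]/(val p.1 * val l).
by rewrite -mulrA lt0 mulr0 (lin0 phil) scale0r.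
Qed.

End Intersection.

(** * Transport of the Hopf algebra axioms along an isomorphism *)

Lemma hopf_iso_is_hopf (k : fieldType) (V W : lmodType k)
    (D : hopf_data V) (E : hopf_data W) (f : V -> W) :
  is_hopf E -> hopf_iso D E f -> is_hopf D.
Proof.
move=> HE [fl [f' fK f'K] fM f1 fD fe fS].
have f'l : linear f'.
  by move=> a x y; apply: (can_inj fK); rewrite fl !f'K.
(* Each tensor-valued or vector-valued axiom is checked after applying f, f (x) f or f (x) f (x) f;
   these are injective because the inverse of f is linear. *)
have inj := can_inj fK.
have inj2 : injective (tmap f f).
  exact: can_inj (tmap_cancel fl fl f'l f'l fK fK).
have [mb mA m1l m1r Dl el DA eDl eDr DM D1 eM e1 Sl SDl SDr] := HE.
have mDb : bilinear_for *:%R *:%R (hmul D).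
  split=> [w a x y|w a x y] /=; apply: inj; rewrite fl !fM fl.
    exact: mb.1.
  exact: mb.2.
have Dcl : linear (hcomul D).
  by move=> a x y; apply: inj2; rewrite (tmap_linear fl fl) !fD fl Dl.
have tf (U : lmodType k) (h : W -> W -> U) x : bilinear_for *:%R *:%R h ->
    tlift (fun a b => h (f a) (f b)) (hcomul D x) = tlift h (hcomul E (f x)).
  by move=> hb; rewrite -fD tlift_tmap.
split=> //.
- by move=> x y z; apply: inj; rewrite !fM mA.
- by move=> x; apply: inj; rewrite fM f1 m1l.
- by move=> x; apply: inj; rewrite fM f1 m1r.
- by move=> a x y; rewrite -!fe fl el.
- move=> x; have ffl := tmap_linear fl fl; have f'f'l := tmap_linear f'l f'l.
  have inj3 : injective (tmap f (tmap f f)).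
    by apply: can_inj (tmap_cancel fl ffl f'l f'f'l fK _); apply: tmap_cancel.
  apply: inj3; rewrite -tassoc_tmap // !tmap_tmap //.
  have fDE : tmap f f \o hcomul D = hcomul E \o f by apply/funext => y /=.
  rewrite fDE -[f \o id]/(id \o f) -(tmap_tmap fl fl Dl (h' := id)) //.
  by rewrite -(tmap_tmap fl fl (g' := id) _ Dl) // fD DA.
- move=> x; apply: inj; rewrite (linear_tlift _ fl) -[RHS]eDl.
  have el' : linear (hcounit E : W -> k^o) by exact: el.
  rewrite -(tf _ (fun a b => hcounit E a *: b)); last by lin.
  by apply: tlift_ext => a b; rewrite (linZ fl) fe.
- move=> x; apply: inj; rewrite (linear_tlift _ fl) -[RHS]eDr.
  have el' : linear (hcounit E : W -> k^o) by exact: el.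
  rewrite -(tf _ (fun a b => hcounit E b *: a)); last by lin.
  by apply: tlift_ext => a b; rewrite (linZ fl) fe.
- by move=> x y; apply: inj2; rewrite (tmap_tmul mDb mb fl fM) !fD fM DM.
- by apply: inj2; rewrite tmap_pure // fD f1 D1.
- by move=> x y; rewrite -!fe fM eM.
- by rewrite -fe f1 e1.
- by move=> a x y; apply: inj; rewrite fl !fS fl Sl.
- move=> x; apply: inj; rewrite (linear_tlift _ fl) (linZ fl) f1 -fe -SDl.
  rewrite -(tf _ (fun a b => hmul E (hantip E a) b)); last by lin.
  by apply: tlift_ext => a b; rewrite fM fS.
- move=> x; apply: inj; rewrite (linear_tlift _ fl) (linZ fl) f1 -fe -SDr.
  rewrite -(tf _ (fun a b => hmul E a (hantip E b))); last by lin.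
  by apply: tlift_ext => a b; rewrite fM fS.
Qed.

(** * The multiplication map *)

Section SmashProduct.
Variables (k : fieldType) (H : hopfAlg k) (A L : hopfSub H).
Hypothesis nA : normal_hopf A.
Local Notation AtL := (tens (hsub A) (hsub L)).

Definition mult_map : AtL -> H := tlift (fun a l => val a * val l).

Lemma mult_bilinear :
  bilinear_for *:%R *:%R (fun (a : hsub A) (l : hsub L) => val a * val l).
Proof. lin. Qed.

Lemma mult_map_linear : linear mult_map.
Proof. exact: tlift_linear mult_bilinear. Qed.

Lemma mult_map_pure a l : mult_map (a \ox l) = val a * val l.
Proof. exact: tlift_pure mult_bilinear _ _. Qed.

Let Ml := mult_map_linear.

(** a (l_1 . a') l_2 l' = a l a' l' by [mul_adjl]. *)
Lemma mult_mapM x y : mult_map (smash_mul nA x y) = mult_map x * mult_map y.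
Proof.
rewrite [LHS](linear_tlift _ Ml).
rewrite [RHS](linear_tlift _ (lin_mull _ (@lin_id _ _))).
apply: tlift_ext => a l; rewrite (linear_tlift _ Ml).
rewrite [RHS](linear_tlift _ (lin_mulr _ (@lin_id _ _))).
apply: tlift_ext => a' l'; rewrite (linear_tlift _ Ml).
have := congr1 (fun z => val a * z * val l') (mul_adjl (val l) (val a')).
rewrite /= !mulrA => <-; rewrite sw_val; last by rewrite /adjl; lin.
rewrite (linear_tlift _ (lin_mulr _ (@lin_id _ _))).
rewrite (linear_tlift _ (lin_mull _ (@lin_id _ _))).
by apply: tlift_ext => l1 l2; rewrite mult_map_pure /= !mulrA.
Qed.

Lemma mult_map_comul T :
  tmap mult_map mult_map (tens_comul (@sub_comul k H A) (@sub_comul k H L) T) =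
  comul (mult_map T).
Proof.
have MMl := tmap_linear Ml Ml.
rewrite (linear_tlift _ MMl) (linear_tlift _ (@lin_comul _ H)).
apply: tlift_ext => a l; rewrite -[RHS]tlift_id.
rewrite (@sw_mul _ H _ (fun a b => a \ox b)); last by lin.
rewrite sw_val; last by lin.
rewrite (linear_tlift _ MMl); apply: tlift_ext => a1 a2.
rewrite (linear_tlift _ MMl).
rewrite (@sw_val _ H L _ (fun c d => (val a1 * c) \ox (val a2 * d)));
  last by lin.
by apply: tlift_ext => l1 l2; rewrite tmap_pure // !mult_map_pure.
Qed.

Lemma mult_map_counit T : counit (mult_map T) = smash_counit T.
Proof.
rewrite [LHS](linear_tlift _ (@lin_counit _ H)).
by apply: (@tlift_ext _ _ _ k^o) => a l; rewrite counitM.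
Qed.

Lemma in_prod_spanP x : in_prod_span A L x <-> exists T, mult_map T = x.
Proof.
split=> [[s sAL ->]|[T <-]]; last first.
  exists [seq (val p.1, val p.2) | p <- tens_repr T]; last by rewrite big_map.
  by move=> _ /mapP[p _ ->]; split; apply: valP.
exists (\sum_(p <- [seq (insubd 0 q.1, insubd 0 q.2) | q <- s]) p.1 \ox p.2).
rewrite [LHS](tlift_sum mult_bilinear) big_map big_seq [RHS]big_seq.
by apply: eq_bigr => p /sAL[pA pL] /=; rewrite !insubdK.
Qed.

(** S(a l) = S(l) S(a) is the image of the smash product (1 # S(l))(S(a) # 1), so the image is
    stable under the antipode. *)
Lemma antip_mult_map T :
  exists T', mult_map T' = antip (mult_map T).
Proof.
exists (tlift (fun a l =>
  smash_mul nA (1 \ox sub_antip l) (sub_antip a \ox 1)) T).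
rewrite (linear_tlift _ Ml) (linear_tlift _ (@lin_antip _ H)).
apply: tlift_ext => a l; rewrite mult_mapM !mult_map_pure antipM.
by rewrite mul1r mulr1.
Qed.

Definition prod_pred : {pred H} := [pred x | `[< in_prod_span A L x >]].

Let predP x : reflect (exists T, mult_map T = x) (x \in prod_pred).
Proof. by apply: (iffP (asboolP _)) => /in_prod_spanP. Qed.

Lemma prod_subalg : subalg_closed prod_pred.
Proof.
split=> [|a _ _ /predP[x <-] /predP[y <-]|_ _ /predP[x <-] /predP[y <-]].
- by apply/predP; exists (1 \ox 1); rewrite mult_map_pure mul1r.
- by apply/predP; exists (a *: x + y); rewrite Ml.
- by apply/predP; exists (smash_mul nA x y); rewrite mult_mapM.
Qed.

Lemma prod_comul x : x \in prod_pred ->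
  exists2 s : seq (H * H),
    {in s, forall p, (p.1 \in prod_pred) /\ (p.2 \in prod_pred)} &
    comul x = \sum_(p <- s) p.1 \ox p.2.
Proof.
move=> /predP[T <-]; rewrite -mult_map_comul; set Z := tens_comul _ _ T.
exists [seq (mult_map p.1, mult_map p.2) | p <- tens_repr Z].
  by move=> _ /mapP[p _ ->]; split; apply/predP; [exists p.1|exists p.2].
by rewrite big_map.
Qed.

Lemma prod_antip x : x \in prod_pred -> antip x \in prod_pred.
Proof. by move=> /predP[T <-]; apply/predP/antip_mult_map. Qed.

Definition prod_hopfSub : hopfSub H :=
  HopfSub prod_subalg prod_comul prod_antip.

Variables (t : hsub A) (u : hsub L).
Hypothesis tI : normalized_integral (t : sub_hopfAlg A).
Hypothesis uI : normalized_integral (u : sub_hopfAlg L).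
Hypothesis capAL : forall x : H, x \in A -> x \in L -> exists c : k, x = c%:A.

(* Multiplying the second factor of comul (a l) by t, then inverting l |-> l t,
   recovers a l_1 (x) l_2, hence a (x) l. *)
Lemma mult_map_inj : injective mult_map.
Proof.
pose g (l : hsub L) := val l * val t.
have gl : linear g by rewrite /g; lin.
have [s sl sK] := linear_pinv gl.
have gK l : s (g l) = l.
  apply/eqP; rewrite -subr_eq0; apply/eqP/(mul_integral_eq0 nA tI uI capAL).
  by rewrite -/(g _) (linB gl) sK subrr.
have [r rl rK] := hsub_retraction A.
(* On x (x) y = a l_1 (x) l_2, where [s] recovers l_2 from l_2 t, this yields a l_1 S(l_2) (x) l_3 =
   a (x) l. The retraction [r] is there because x S(l_2) need not lie in A term by term. *)
pose F x y := tlift (fun l1 l2 => r (x * antip (val l1)) \ox l2)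
  (sub_comul (s (y * val t))).
have cl := @sub_comul_linear k H L.
have Fb : bilinear_for *:%R *:%R F by rewrite /F; lin.
apply: (@can_inj _ _ _ (fun x => \sw_(a, b <- x) F a b)) => T.
pose G x := \sw_(a, b <- x) F a b.
have Gl : linear G by rewrite /G; lin.
rewrite -/(G _) (linear_tlift _ Gl) -[RHS]tlift_id.
apply: tlift_ext => a l; rewrite /G sw_mul // sw_val; last by lin.
pose h (a : sub_hopfAlg A) : AtL := a \ox l.
rewrite -[RHS]/(h a) -(@sw_counitr _ (sub_hopfAlg A) _ h); last first.
  by rewrite /h; lin.
apply: tlift_ext => a1 a2; rewrite sw_val; last by lin.
pose f (b c : sub_hopfAlg L) : AtL := r (val a1 * val (b : hsub L)) \ox c.
have fb : bilinear_for *:%R *:%R f by rewrite /f; lin.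
transitivity (counit (val a2) *: f 1 l); last by rewrite /f mulr1 rK.
rewrite -(sw_antiprK _ fb).
rewrite (linear_tlift _ (lin_scaler _ (@lin_id _ _))).
(* Centrality of t gives a_2 l_2 t = a_2 t l_2 = counit(a_2) l_2 t. *)
apply: tlift_ext => l1 l2; rewrite /F -mulrA (integral_central nA tI) mulrA.
rewrite (val_integrall tI (valP a2)) -scalerAl -(integral_central nA tI).
rewrite (linZ sl) gK.
have cZ (x : hsub L) :
    sub_comul (counit (val a2) *: x) = counit (val a2) *: sub_comul x.
  exact: (linZ cl).
rewrite cZ.
pose K (z : tens (hsub L) (hsub L)) : AtL :=
  tlift (fun l3 l4 => r (val a1 * val l1 * antip (val l3)) \ox l4) z.
have Kl : linear K by rewrite /K; lin.
rewrite -/(K _) (linZ Kl); congr (_ *: _).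
by apply: tlift_ext => l3 l4; rewrite /f mulrA.
Qed.

End SmashProduct.

(** * The isomorphism between the smash product and [AL] *)

Theorem corollary3p4 (k : closedFieldType) (k_char0 : [pchar k] =i pred0)
    (H : hopfAlg k) (A L : hopfSub H)
    (A_semisimple : semisimple_ring (hsub A))
    (L_semisimple : semisimple_ring (hsub L))
    (A_cap_L : forall x : H,
      (x \in A) /\ (x \in L) <-> exists c : k, x = c%:A)
    (A_normal : normal_hopf A) :
  exists (AL : hopfSub H)
         (S : tens (hsub A) (hsub L) -> tens (hsub A) (hsub L))
         (phi : tens (hsub A) (hsub L) -> hsub AL),
    [/\ forall x : H, x \in AL <-> in_prod_span A L x,
        is_hopf (smash_data L A_normal S),
        forall (a : hsub A) (l : hsub L), val (phi (a \ox l)) = val a * val l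
      & hopf_iso (smash_data L A_normal S) (sub_data AL) phi].
Proof.
have [t tI] := @semisimple_integral k (sub_hopfAlg A) A_semisimple.
have [u uI] := @semisimple_integral k (sub_hopfAlg L) L_semisimple.
have capAL x : x \in A -> x \in L -> exists c : k, x = c%:A.
  by move=> Ax Lx; apply/A_cap_L.
have Minj := mult_map_inj A_normal tI uI capAL.
pose AL := prod_hopfSub L A_normal.
have MAL (T : tens (hsub A) (hsub L)) : mult_map T \in AL.
  by apply/asboolP/in_prod_spanP; exists T.
pose phi T : hsub AL := exist (fun x => x \in hsub_pred AL) _ (MAL T).
have phil : linear phi.
  by move=> a x y; apply: val_inj; rewrite [LHS]mult_map_linear.
have /choice[phi' phi'K] : forall y : hsub AL, exists T, phi T = y.
  move=> y; have /asboolP/in_prod_spanP[T TE] := valP y.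
  by exists T; apply: val_inj.
have phiK : cancel phi phi'.
  by move=> T; apply: Minj; have /(congr1 val) := phi'K (phi T).
(* The antipode of the smash product is that of [AL] pulled back along phi. *)
pose S T := phi' (sub_antip (phi T)).
have iso : hopf_iso (smash_data L A_normal S) (sub_data AL) phi.
  split=> //=.
  - by exists phi'.
  - by move=> x y; apply: val_inj; rewrite [LHS]mult_mapM.
  - by apply: val_inj; rewrite [LHS]mult_map_pure mul1r.
  - move=> x; apply: hsub_tmap_inj; rewrite sub_comulE tmap_tmap //; try lin.
    exact: mult_map_comul.
  - exact: mult_map_counit.
  - by move=> x; apply: phi'K.
exists AL, S, phi; split=> //.
- by move=> x; split=> [/asboolP|xAL] //; apply/asboolP.
(* The Hopf axioms of the smash product are transported from the Hopf subalgebra [AL], which avoids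
   verifying them on tensors. *)
- exact: hopf_iso_is_hopf (sub_hopf AL) iso.
- exact: mult_map_pure.
Qed.
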